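(* There exists a constant $C>0$ such that for every real $\lambda>1$ and every map $p\mapsto q=q(p)$ from the nonnegative integers to the positive integers satisfying $q(p)>\max(\lambda p,\,p+4)$ for all $p$, one has $$\|u\|_{H^1_0(\Omega)}\le C\,\frac{\lambda}{\lambda-1}\,\|u_q\|_{H^1_0(\Omega)}\qquad\text{for all integers } p\ge 0 \text{ and all } f\in\mathbb{P}_p(\Omega),$$ where $q=q(p)$, $u=u(f)\in H^1_0(\Omega)$ is the variational solution of the homogeneous Dirichlet problem for $-\Delta u=f$ in $\Omega$, and $u_q=u_q(f)\in\mathcal{V}_q$ is its Galerkin approximation in $\mathcal{V}_q$.
   Context: Let $\Omega=(-1,1)^2\subset\mathbb{R}^2$. For an integer $p\ge0$, $\mathbb{P}_p(\Omega)$ is the space of (real) polynomials in two variables of total degree $\le p$, restricted to $\Omega$. For an integer $q\ge4$, $\mathcal{V}_q:=\mathbb{P}_q(\Omega)\cap H^1_0(\Omega)$. The space $H^1_0(\Omega)$ is equipped with the inner product $(v,w)_{H^1_0(\Omega)}:=(\nabla v,\nabla w)_{L^2(\Omega)^2}$ and the resulting norm $\|\cdot\|_{H^1_0(\Omega)}$. Given $f\in\mathbb{P}_p(\Omega)$, $u=u(f)\in H^1_0(\Omega)$ is the unique function with $(u,v)_{H^1_0(\Omega)}=(f,v)_{L^2(\Omega)}$ for all $v\in H^1_0(\Omega)$, and for $q\ge4$, $u_q=u_q(f)\in\mathcal{V}_q$ is the unique function with $(u_q,v_q)_{H^1_0(\Omega)}=(f,v_q)_{L^2(\Omega)}$ for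 all $v_q\in\mathcal{V}_q$. *)

(* Defs.v *)
From HB Require Import structures.
From mathcomp Require Import all_boot all_order all_algebra.
From mathcomp Require Import all_classical all_reals all_analysis.

Set Implicit Arguments.
Unset Strict Implicit.
Unset Printing Implicit Defensive.

Import Order.TTheory GRing.Theory Num.Theory.
Import numFieldNormedType.Exports.

Local Open Scope classical_set_scope.
Local Open Scope ring_scope.

Section Square.
Context {R : realType}.

Definition square : set (R * R) := `]-1, 1[%classic `*` `]-1, 1[%classic.

Lemma measurable_square : measurable square.
Proof. exact: measurableX. Qed.

(* A function on the square is represented by a function on the whole plane,
   whose values off the square are irrelevant: all the integrals and all the
   "almost everywhere" are with respect to this restricted measure. *)
Definition lebesgue_square :=
  mrestr (@lebesgue_measure R \x @lebesgue_measure R)%E measurable_square.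

Definition L2_square : {pred R * R -> R} := Lfun lebesgue_square 2%:E.

Definition dotL2 (f g : R * R -> R) : R :=
  (\int[lebesgue_square]_z (f z * g z))%R.

Definition partial_x (f : R * R -> R) : R * R -> R := 'D_(1, 0) f.
Definition partial_y (f : R * R -> R) : R * R -> R := 'D_(0, 1) f.

Fixpoint Ck (k : nat) (f : R * R -> R) : Prop :=
  if k is j.+1 then
    [/\ continuous f,
        forall z, derivable f z (1, 0), Ck j (partial_x f),
        forall z, derivable f z (0, 1) & Ck j (partial_y f)]
  else continuous f.

Definition closed_support (f : R * R -> R) : set (R * R) :=
  closure [set z | f z != 0].

(* Elements of C_c^oo(square), extended by zero to the plane. *)
Definition test_function (phi : R * R -> R) : Prop :=
  [/\ forall k, Ck k phi,
      compact (closed_support phi) & closed_support phi `<=` square].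

(* An element of H^1(square) is carried by a square-integrable representative
   together with (representatives of) its weak partial derivatives, which are
   determined almost everywhere by the function. *)
Record H1_square := MkH1 {
  H1_fun :> R * R -> R;
  weak_x : R * R -> R;
  weak_y : R * R -> R;
  H1_fun_L2 : H1_fun \in L2_square;
  weak_x_L2 : weak_x \in L2_square;
  weak_y_L2 : weak_y \in L2_square;
  weak_xP : forall phi, test_function phi ->
    dotL2 H1_fun (partial_x phi) = - dotL2 weak_x phi;
  weak_yP : forall phi, test_function phi ->
    dotL2 H1_fun (partial_y phi) = - dotL2 weak_y phi
}.

(* H^1_0 is the closure of the test functions in the norm of H^1; the integral
   is the square of the H^1-distance from u to phi. *)
Definition H10_square : set H1_square := [set u : H1_square |
  forall e : R, 0 < e -> exists2 phi, test_function phi &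
    (\int[lebesgue_square]_z
       ((u z - phi z) ^+ 2 + (weak_x u z - partial_x phi z) ^+ 2
        + (weak_y u z - partial_y phi z) ^+ 2)%:E < (e ^+ 2)%:E)%E].

Definition dotH10 (v w : H1_square) : R :=
  (\int[lebesgue_square]_z
     (weak_x v z * weak_x w z + weak_y v z * weak_y w z))%R.

Definition normH10 (v : H1_square) : R := Num.sqrt (dotH10 v v).

(* The outer variable of P is the second coordinate; total degree at most p. *)
Definition poly_square (p : nat) : set (R * R -> R) :=
  [set f | exists2 P : {poly {poly R}},
     (forall i j : nat, P`_i`_j != 0 -> (i + j <= p)%N) &
     f = (fun z : R * R => P.[z.2%:P].[z.1])].

Definition Vspace (q : nat) : set H1_square := [set v : H1_square |
  H10_square v /\ exists2 f, poly_square q f &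
    {ae lebesgue_square, forall z, v z = f z}].

Definition dirichlet_solution (f : R * R -> R) (u : H1_square) : Prop :=
  H10_square u /\ forall v, H10_square v -> dotH10 u v = dotL2 f v.

Definition galerkin_solution (q : nat) (f : R * R -> R) (uq : H1_square) :
  Prop := Vspace q uq /\ forall v, Vspace q v -> dotH10 uq v = dotL2 f v.

End Square.

Arguments H1_square : clear implicits.

(* Main.v *)
(** Let L_i be the Legendre polynomials and B_i the primitive of L_i vanishing at
   -1 and 1.  The solution u has moments U_ij against L_i'(x) L_j'(y), and for f
   of degree at most p the number (f, u) depends only on those of total degree at
   most p.  Multiply U_ij by a factor equal to 1 for these, equal to 0 when
   B_i(x) B_j(y) has degree beyond q, and affine in the total degree in between;
   the damped moments are those of a polynomial w in V_q, so (f, w) = (f, u).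

   For fixed i, the coefficients of the x-derivatives of u and of w on
   L_i(x) L_k(y) are, up to the same normalisation, differences E_k - E_(k+2) of
   the sequences of moments, with E_0 = E_1 = 0.  A discrete Leibniz rule and a
   discrete Hardy inequality on {0, .., q} then give |w| <= C (1 + q s) |u|, with s
   of order 1 / (q - p) the slope of the damping factor.  Since q > lambda p,
   q / (q - p) <= lambda / (lambda - 1), and the theorem follows from
   |u|^2 = (f, u) = (f, w) = (u_q, w) <= |u_q| |w|. *)
Require Import Defs.
From HB Require Import structures.
From mathcomp Require Import all_boot all_order all_algebra.
From mathcomp Require Import all_classical all_reals all_analysis.
From mathcomp Require Import ring lra.

Set Implicit Arguments.
Unset Strict Implicit.
Unset Printing Implicit Defensive.

Import Order.TTheory GRing.Theory Num.Theory.
Import numFieldNormedType.Exports.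

Local Open Scope classical_set_scope.
Local Open Scope ring_scope.

(** * Legendre polynomials and their primitives *)

Section Legendre.
Context {R : realFieldType}.
Implicit Types (p r : {poly R}) (i j k n : nat).

(** A sharp cut at degree q would be a damping factor jumping from 1 to 0: at the jump the
    difference E_k - E_(k+2) is replaced by E_k alone, and the Hardy inequality then only gives a
    factor growing like q. Spreading the descent over the available degrees divides this loss by
    about q - p. The factor depends on the total degree only, so for fixed i it is a sequence in k
    with the same slope, and the two partial derivatives can be treated alike.

    The moments are taken against L_i'(x) L_j'(y) because these products are biorthogonal to B_i(x)
    B_j(y): prescribing the moments of w amounts to prescribing its coefficients. The products
    L_i(x) L_k(y) do not vanish on the boundary, so integrating the weak derivatives of u by parts
    against them uses that u is a limit of test functions. Conversely, w belongs to H^1_0 only once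
    products of bubbles are shown to be such limits, which is done with explicit cutoffs. *)

Definition primitive p : {poly R} := \poly_(k < (size p).+1) (p`_k.-1 / k%:R).

(** At [k = 0] the division by [0%:R] yields 0, so the formula also covers the vanishing constant
    coefficient. *)
Lemma coef_primitive p k : (primitive p)`_k = p`_k.-1 / k%:R.
Proof.
rewrite coef_poly; case: ltnP => // pk.
by case: k pk => // k pk; rewrite nth_default ?mul0r.
Qed.

Lemma deriv_primitive p : (primitive p)^`() = p.
Proof.
apply/polyP => k; rewrite coef_deriv coef_primitive /=.
by rewrite -[LHS]mulr_natr mulfVK ?pnatr_eq0.
Qed.

(** The integral over [-1, 1], defined algebraically; [pint_integral] identifies it with the
    Lebesgue integral over the open interval. *)
Definition pint p : R := (primitive p).[1] - (primitive p).[-1].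

Lemma pint_is_linear : scalar pint.
Proof.
move=> a p r; rewrite /pint.
have -> : primitive (a *: p + r) = a *: primitive p + primitive r.
  apply/polyP => k; rewrite !(coefD, coefZ, coef_primitive) mulrDl.
  by rewrite mulrA.
by rewrite !hornerE /GRing.scale/=; ring.
Qed.
HB.instance Definition _ :=
  GRing.isLinear.Build R {poly R} R *%R pint pint_is_linear.

Lemma pint_deriv p : pint p^`() = p.[1] - p.[-1].
Proof.
have -> : p = primitive p^`() + (p`_0)%:P.
  apply/polyP => -[|k]; rewrite coefD coefC coef_primitive /=.
    by rewrite invr0 mulr0 add0r.
  by rewrite coef_deriv addr0 -[X in X / _]mulr_natr mulfK ?pnatr_eq0.
by rewrite derivD derivC addr0 deriv_primitive !hornerE /pint; ring.
Qed.

Lemma pint_parts p r : p.[1] = 0 -> p.[-1] = 0 ->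
  pint (p^`() * r) = - pint (p * r^`()).
Proof.
move=> p1 pN1; apply/eqP; rewrite -addr_eq0 -raddfD/= -derivM pint_deriv.
by rewrite !hornerM p1 pN1 !mul0r subrr.
Qed.

Definition leg_base k : {poly R} := ('X^2 - 1) ^+ k.

Definition leg_scale k : R := 2 ^+ k * k`!%:R.

Lemma leg_scale_neq0 k : leg_scale k != 0.
Proof. by rewrite mulf_neq0 ?expf_neq0 ?pnatr_eq0// -lt0n fact_gt0. Qed.

Lemma leg_scaleS k : leg_scale k.+1 = 2 * k.+1%:R * leg_scale k.
Proof. by rewrite /leg_scale exprS factS natrM; ring. Qed.

(* Rodrigues' formula. *)
Definition leg k : {poly R} := (leg_scale k)^-1 *: (leg_base k)^`(k).

(** The index is shifted: this is the primitive of [leg k.+1], of degree k + 2, that is B_(k+1). The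
    constant L_0 has no primitive vanishing at both endpoints. *)
Definition bubble k : {poly R} :=
  (leg_scale k.+1)^-1 *: (leg_base k.+1)^`(k).

Lemma deriv_leg_base k :
  (leg_base k.+1)^`() = (2 * k.+1%:R) *: ('X * leg_base k).
Proof.
rewrite /leg_base deriv_exp /= derivB derivXn derivC subr0 /= expr1.
by rewrite -mul_polyC polyCM !polyC_natr; ring.
Qed.

(** The factor X^2 produced by differentiating twice is rewritten as (X^2 - 1) + 1, which leaves two
    consecutive powers. *)
Lemma deriv2_leg_base k : (leg_base k.+2)^`(2) =
  (2 * k.+2%:R) *: ((2 * k.+1%:R + 1) *: leg_base k.+1
                    + (2 * k.+1%:R) *: leg_base k).
Proof.
rewrite !derivnS derivn0 deriv_leg_base !derivZ derivM derivX deriv_leg_base.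
rewrite /leg_base !exprS.
rewrite -!mul_polyC !(polyCM, polyCD) !polyC_natr; ring.
Qed.

Lemma deriv_bubble k : (bubble k)^`() = leg k.+1.
Proof. by rewrite /bubble /leg derivZ derivnS. Qed.

(** The classical relation (2n + 1) B_n = L_(n+1) - L_(n-1) at n = k + 1, obtained by
    differentiating [deriv2_leg_base] k more times. It is the source of all the differences of step
    two. *)
Lemma bubbleE k : bubble k = (2 * k.+1%:R + 1)^-1 *: (leg k.+2 - leg k).
Proof.
have nz : 2 * k.+1%:R + 1 != 0 :> R by rewrite -natrM natr1 pnatr_eq0.
apply: (canRL (scalerK nz)).
rewrite /bubble /leg.
have -> : (leg_base k.+2)^`(k.+2) = ((leg_base k.+2)^`(2))^`(k).
  by rewrite /derivn -iterD addnC.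
rewrite deriv2_leg_base !(derivnZ, derivnD) !leg_scaleS.
rewrite !scalerDr !scalerA.
have := leg_scale_neq0 k; set s := leg_scale k => s0.
rewrite -addrA -scaleNr -scalerDl; set a := (X in X *: _ + _).
set b := (X in _ + X *: _).
have -> : b = 0 by rewrite /b; field; rewrite s0 nat1r -natrD !pnatr_eq0.
rewrite scale0r addr0; congr (_ *: _).
by rewrite /a; field; rewrite s0 nat1r -natrD !pnatr_eq0.
Qed.

Lemma leg0 : leg 0 = 1.
Proof. by rewrite /leg /leg_scale /leg_base !expr0 mul1r invr1 scale1r. Qed.

Lemma leg1 : leg 1 = 'X.
Proof.
rewrite /leg /leg_scale derivn1 deriv_leg_base /leg_base expr0 mulr1 !scalerA.
rewrite mulr1 mulVf ?scale1r//.
Qed.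

(** Each differentiation removes at most one factor X^2 - 1. Besides the zeros at the endpoints,
    this provides the factor X^2 - 1 of [bubble] that later absorbs the derivative of the cutoff. *)
Lemma derivn_base_div j k : (j <= k)%N ->
  exists r, (leg_base k)^`(j) = ('X^2 - 1) ^+ (k - j) * r.
Proof.
elim: j => [_|j IH jk]; first by exists 1; rewrite mulr1 subn0.
have [r Er] := IH (ltnW jk); rewrite derivnS Er -(subnSK jk).
set a : {poly R} := 'X^2 - 1.
set n := (k - j.+1)%N.
exists ((a^`() * r) *+ n.+1 + a * r^`()).
by rewrite derivM deriv_exp /= exprS; ring.
Qed.

Lemma derivn_base_root j k x : (j < k)%N -> x ^+ 2 = 1 -> (leg_base k)^`(j).[x] = 0.
Proof.
move=> jk x1; have [r ->] := derivn_base_div (ltnW jk).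
by rewrite !hornerE x1 subrr expr0n subn_eq0 leqNgt jk mul0r.
Qed.

Lemma bubble_div k : exists r, bubble k = ('X^2 - 1) * r.
Proof.
have [r Er] := derivn_base_div (leqnSn k).
exists ((leg_scale k.+1)^-1 *: r).
by rewrite /bubble Er subSnn expr1 scalerAr.
Qed.

Lemma bubble_root k x : x ^+ 2 = 1 -> (bubble k).[x] = 0.
Proof. by have [r ->] := bubble_div k => x1; rewrite !hornerE x1 subrr mul0r. Qed.

Lemma size_leg k : size (leg k) = k.+1.
Proof.
have m : leg_base k \is monic by rewrite monic_exp// monicXnsubC.
have sz : size (leg_base k) = (k + k).+1.
  have := size_exp ('X^2 - 1 : {poly R}) k; rewrite size_XnsubC//= -/(leg_base k).
  by rewrite mul2n addnn => <-; rewrite prednK// size_poly_gt0 monic_neq0.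
rewrite /leg size_scale ?invr_eq0 ?leg_scale_neq0//.
apply/eqP; rewrite eqn_leq; apply/andP; split.
  by apply/leq_sizeP => j kj; rewrite coef_derivn nth_default ?mul0rn// sz ltn_add2l.
rewrite ltnNge; apply/negP => /leq_sizeP /(_ _ (leqnn k)) /eqP.
rewrite coef_derivn; have := monicP m; rewrite lead_coefE sz /= => ->.
by rewrite pnatr_eq0 eqn0Ngt ffact_gt0 leq_addr.
Qed.

(** Integrating Rodrigues' formula by parts k times leaves no boundary term and kills a factor of
    degree below k. *)
Lemma pint_leg_lower k p : (size p <= k)%N -> pint (leg k * p) = 0.
Proof.
move=> pk; rewrite /leg -scalerAl linearZ /=.
suff IBP j r : (j <= k)%N ->
    pint ((leg_base k)^`(j) * r) = (-1) ^+ j * pint (leg_base k * r^`(j)).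
  by rewrite IBP// derivn_poly0 // mulr0 linear0 !mulr0.
elim: j r => [|j IH] r jk; first by rewrite mul1r.
rewrite derivnS pint_parts ?derivn_base_root ?sqrrN ?expr1n//.
by rewrite IH ?(ltnW jk)// -derivSn exprS mulN1r mulNr.
Qed.

Definition leg_sqnorm k : R := 2 / (2 * k%:R + 1).

Lemma leg_sqnorm_gt0 k : 0 < leg_sqnorm k.
Proof. by rewrite divr_gt0// ltr_wpDl// mulr_ge0. Qed.

Lemma leg_sqnorm_le j k : (j <= k)%N -> leg_sqnorm k <= leg_sqnorm j.
Proof.
move=> jk; rewrite ler_pM2l// lef_pV2 ?posrE ?ltr_wpDl ?mulr_ge0//.
by rewrite lerD2r ler_pM2l// ler_nat.
Qed.

(** Bubbles vanish at the endpoints, so [bubbleE] gives L_(k+2) = L_k there and an induction of step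
    two suffices. *)
Lemma leg_endpoints k x : x ^+ 2 = 1 -> (leg k).[x] = x ^+ k.
Proof.
move=> x1; elim/ltn_ind: k => -[|[|k]] IH; first by rewrite leg0 hornerC.
  by rewrite leg1 hornerX.
have := bubble_root k x1; rewrite bubbleE hornerZ hornerD hornerN => /eqP.
rewrite mulf_eq0 invr_eq0 -natrM natr1 pnatr_eq0/= subr_eq0 => /eqP ->.
by rewrite IH// -addn2 exprD x1 mulr1.
Qed.

Lemma size_bubble k : (size (bubble k) <= k + 3)%N.
Proof.
rewrite bubbleE; apply: leq_trans (size_scale_leq _ _) _.
apply: leq_trans (size_polyD _ _) _.
by rewrite size_polyN !size_leg geq_max addn3 leqnn /= leqW.
Qed.

(* [leg] at the predecessor, so that the recurrence below is uniform in k;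
   both [dleg 0] and [dleg 1] vanish. *)
Definition dleg k : {poly R} := (leg k.-1)^`().

Lemma dleg0 : dleg 0 = 0.
Proof. by rewrite /dleg /= leg0 derivC. Qed.

Lemma dleg1 : dleg 1 = 0.
Proof. by rewrite /dleg /= leg0 derivC. Qed.

Lemma leg_dleg k : leg k = (leg_sqnorm k / 2) *: (dleg k.+2 - dleg k).
Proof.
have nz : 2 * k%:R + 1 != 0 :> R by rewrite -natrM natr1 pnatr_eq0.
have -> : leg_sqnorm k / 2 = (2 * k%:R + 1)^-1 by rewrite /leg_sqnorm; field.
case: k nz => [|k] nz.
  by rewrite dleg0 /dleg /= leg1 derivX mulr0 add0r invr1 subr0 scale1r leg0.
by rewrite -deriv_bubble bubbleE derivZ derivB.
Qed.

Lemma size_dleg k : (size (dleg k) <= k.-1)%N.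
Proof. by rewrite -ltnS -[k.-1.+1](size_leg) lt_size_deriv// -size_poly_eq0 size_leg. Qed.

(** For j = k one factor is expanded by [leg_dleg]; only L_(k+1)' is not of degree below k. The
    integral of L_k L_(k+1)' is the boundary term of L_k L_(k+1), equal to 2, since L_k' is
    orthogonal to L_(k+1). *)
Lemma pint_leg_leg j k : pint (leg j * leg k) = leg_sqnorm k *+ (j == k).
Proof.
have [->|/eqP jk] := eqVneq j k; last first.
  have [|kj|//] := ltngtP j k; last by rewrite pint_leg_lower// size_leg.
  by move=> kj; rewrite mulrC pint_leg_lower// size_leg.
rewrite {2}leg_dleg -scalerAr linearZ /=.
rewrite [leg k * _]mulrBr raddfB /=.
rewrite (pint_leg_lower (p := dleg k)); last first.
  by rewrite (leq_trans (size_dleg k))// leq_pred.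
have := pint_deriv (leg k * leg k.+1); rewrite derivM raddfD /=.
rewrite [X in pint X + _]mulrC (pint_leg_lower (k := k.+1)) ?add0r; last first.
  by apply: leq_trans (size_dleg k.+1) (leqnSn _).
rewrite /dleg /= subr0 => ->.
rewrite !hornerM !leg_endpoints ?sqrrN ?expr1n// mul1r.
rewrite [(-1) ^+ k.+1]exprS mulN1r mulrN -expr2 sqrr_sign opprK.
by rewrite mulr1n; field.
Qed.

(** The biorthogonality that turns moments into coefficients in the bubble basis. *)
Lemma pint_bubble_dleg j k :
  pint (bubble j * dleg k.+2) = - (leg_sqnorm k.+1 *+ (j == k)).
Proof.
have := @pint_parts (bubble j) (leg k.+1).
rewrite !bubble_root ?sqrrN ?expr1n// deriv_bubble pint_leg_leg eqSS.
by move=> ->//; rewrite opprK.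
Qed.

(** Triangularity: [dleg k.+2] has degree exactly k, so the top coefficient can be removed by
    induction. *)
Lemma dleg_span n p : (size p <= n)%N ->
  exists c : nat -> R, p = \sum_(k < n) c k *: dleg k.+2.
Proof.
elim: n p => [|n IH] p pn.
  by exists (fun=> 0); rewrite big_ord0; apply/eqP; rewrite -size_poly_leq0.
have sd : (size (dleg n.+2) <= n.+1)%N by exact: size_dleg.
set l := (dleg n.+2)`_n.
have l0 : l != 0.
  rewrite /l /dleg coef_deriv -mulr_natr mulf_neq0 ?pnatr_eq0//.
  have := size_leg n.+1 => sz; rewrite -[n.+1]/(n.+2.-1) -{2}sz -lead_coefE.
  by rewrite lead_coef_eq0 -size_poly_eq0 sz.
have [|c Ec] := IH (p - (p`_n / l) *: dleg n.+2).
  apply/leq_sizeP => i; rewrite leq_eqVlt => /orP[/eqP <-|ni].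
    by rewrite coefB coefZ divfK// subrr.
  rewrite coefB coefZ (nth_default _ (leq_trans pn ni)).
  by rewrite (nth_default _ (leq_trans sd ni)) mulr0 subrr.
exists (fun k => if k == n then p`_n / l else c k).
rewrite big_ord_recr /= eqxx -[LHS](subrK ((p`_n / l) *: dleg n.+2)) Ec.
by congr (_ + _); apply: eq_bigr => i _; rewrite ltn_eqF.
Qed.
End Legendre.

(** * A discrete Hardy inequality *)

Section Hardy.
Context {R : realFieldType}.
Implicit Types (E m g d : nat -> R).

(** One induction step of Cauchy-Schwarz for a sum of n + 1 terms; after multiplication by n it
    reduces to (a + n b)^2 >= 0. *)
Lemma sqr_sub_le n (a b t : R) : 0 <= t -> a ^+ 2 <= n%:R * t ->
  (a - b) ^+ 2 <= n.+1%:R * (t + b ^+ 2).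
Proof.
move=> t0; have [->|n0] := posnP n.
  rewrite mul0r exprn_even_le0//= => /eqP ->; nra.
move=> an; have {}n0 : 0 < n%:R :> R by rewrite ltr0n.
rewrite -natr1 -(ler_pM2l n0); have := sqr_ge0 (a + n%:R * b).
have := ler_wpM2l (ltW n0) an; nra.
Qed.

(* [E k.+2] is minus the sum of the increments along its parity class, of which
   there are at most [k.+1]. *)
Lemma discrete_hardy E g N : E 0%N = 0 -> E 1%N = 0 ->
  (forall k, 0 <= g k) -> (forall j k, (j <= k)%N -> g k <= g j) ->
  \sum_(k < N) g k * E k.+2 ^+ 2 <=
  N%:R ^+ 2 * \sum_(k < N) g k * (E k - E k.+2) ^+ 2.
Proof.
move=> E0 E1 g0 gd; pose d k := E k - E k.+2.
have S0 n : 0 <= \sum_(j < n) d j ^+ 2 by apply: sumr_ge0 => j _; exact: sqr_ge0.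
have sqE k : E k.+2 ^+ 2 <= k.+1%:R * \sum_(j < k.+1) d j ^+ 2.
  have step k' : E k' ^+ 2 <= k'%:R * \sum_(j < k') d j ^+ 2 ->
      E k'.+2 ^+ 2 <= k'.+1%:R * \sum_(j < k'.+1) d j ^+ 2.
    have -> : E k'.+2 = E k' - d k' by rewrite /d; ring.
    move=> h; rewrite big_ord_recr /=.
    exact: sqr_sub_le (S0 _) h.
  pose P k := E k.+2 ^+ 2 <= k.+1%:R * \sum_(j < k.+1) d j ^+ 2.
  suff H : P k /\ P k.+1 by exact: H.1.
  elim: k => [|k [IH1 IH2]].
    split; apply: step; rewrite ?E0 ?E1 ?expr0n /= ?mul0r ?mul1r //; exact: S0.
  split=> //; apply: step; apply: le_trans IH1 _ => /=.
  rewrite [X in _ <= _ * X]big_ord_recr/=.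
  by rewrite ler_pM ?ler_nat ?S0// lerDl sqr_ge0.
(* As [g] is nonincreasing, [g k] is at most every [g j] with [j <= k]: the weight enters the
   partial sum, which is then extended to all N terms. *)
have {}sqE (k : 'I_N) : g k * E k.+2 ^+ 2 <= N%:R * \sum_(j < N) g j * d j ^+ 2.
  apply: (le_trans (ler_wpM2l (g0 k) (sqE k))).
  rewrite mulrCA; apply: ler_pM => //.
  - by rewrite mulr_ge0// sumr_ge0// => j _; rewrite sqr_ge0.
  - by rewrite ler_nat.
  rewrite mulr_sumr (big_ord_widen _ (fun j => g k * d j ^+ 2) (ltn_ord k)).
  rewrite big_mkcond/=; apply: ler_sum => j _; case: ifP => [jk|_].
    by rewrite ler_wpM2r ?sqr_ge0// gd// -ltnS.
  by rewrite mulr_ge0// sqr_ge0.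
apply: le_trans (ler_sum _ (fun k _ => sqE k)) _.
by rewrite sumr_const card_ord -[leLHS]mulr_natl mulrA -expr2.
Qed.

(** The difference splits as m_k (E_k - E_(k+2)) + (m_k - m_(k+2)) E_(k+2), and the outer 2 comes
    from (x + y)^2 <= 2 x^2 + 2 y^2. Only the second term needs Hardy, at the price of delta N. *)
Lemma hardy_multiplier E m g N (delta : R) : E 0%N = 0 -> E 1%N = 0 ->
  (forall k, 0 <= g k) -> (forall j k, (j <= k)%N -> g k <= g j) ->
  (forall k, `|m k| <= 1) -> (forall k, `|m k - m k.+2| <= delta) ->
  \sum_(k < N) g k * (m k * E k - m k.+2 * E k.+2) ^+ 2 <=
  2 * (1 + (delta * N%:R) ^+ 2) * \sum_(k < N) g k * (E k - E k.+2) ^+ 2.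
Proof.
move=> E0 E1 g0 gd m1 md.
have d0 : 0 <= delta by exact: le_trans (normr_ge0 _) (md 0%N).
apply: (@le_trans _ _ (\sum_(k < N) (2 * (g k * (E k - E k.+2) ^+ 2) +
    2 * delta ^+ 2 * (g k * E k.+2 ^+ 2)))).
  apply: ler_sum => k _; set a := E k - E k.+2.
  have -> : m k * E k - m k.+2 * E k.+2
    = m k * a + (m k - m k.+2) * E k.+2 by rewrite /a; ring.
  set b := E k.+2; set x := m k; set y := m k - m k.+2.
  have x1 : x ^+ 2 <= 1.
    by rewrite -real_normK ?num_real// exprn_ile1// m1.
  have y1 : y ^+ 2 <= delta ^+ 2.
    by rewrite -real_normK ?num_real// lerXn2r ?nnegrE ?md.
  rewrite [X in _ <= X](_ : _ =
    g k * (2 * a ^+ 2 + 2 * delta ^+ 2 * b ^+ 2)); last by ring.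
  apply: ler_wpM2l => //.
  have := ler_wpM2r (sqr_ge0 a) x1; have := ler_wpM2r (sqr_ge0 b) y1.
  have := sqr_ge0 (x * a - y * b); nra.
rewrite big_split /= -!mulr_sumr.
have := discrete_hardy N E0 E1 g0 gd.
set A := \sum_(_ < _) _; set B := \sum_(_ < _) _ => AB.
have := ler_wpM2l (sqr_ge0 delta) AB; rewrite exprMn; lra.
Qed.
End Hardy.

(** * Integration on the square *)

Section PlaneMeasurability.
Context {R : realType}.

(** The plane carries the product sigma-algebra, so an open set is written as a countable union of
    boxes with rational centre and radius. *)
Lemma open_plane_measurable (U : set (R * R)) : open U -> measurable U.
Proof.
move=> oU.
pose box (a b e : rat) : set (R * R) :=
  ball (ratr a : R) (ratr e : R) `*` ball (ratr b : R) (ratr e : R).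
pose F a b e := if `[< box a b e `<=` U >] then box a b e else set0.
suff -> : U = \bigcup_a \bigcup_b \bigcup_e F a b e.
  do 3![apply: bigcupT_measurable_rat => ?]; rewrite /F; case: ifP => // _.
  by apply: measurableX; by rewrite ball_itv.
apply/seteqP; split=> [z Uz|z [a _ [b _ [e _]]]]; last first.
  by rewrite /F; case: ifPn => // /asboolP; apply.
have /nbhs_ballP[d /= d0 dU] : nbhs z U by exact: open_nbhs_nbhs.
have [e] := @rat_in_itvoo R 0 (d / 2) ltac:(lra).
rewrite in_itv /= => /andP[e0 ed].
have [a] := @rat_in_itvoo R (z.1 - ratr e) (z.1 + ratr e) ltac:(lra).
have [b] := @rat_in_itvoo R (z.2 - ratr e) (z.2 + ratr e) ltac:(lra).
rewrite !in_itv/= => /andP[b1 b2] /andP[a1 a2].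
exists a => //; exists b => //; exists e => //.
have bU : box a b e `<=` U.
  move=> y [/= y1 y2]; apply: dU; split => /=.
    by move: y1; rewrite /ball /= !ltr_norml => /andP[? ?]; lra.
  by move: y2; rewrite /ball /= !ltr_norml => /andP[? ?]; lra.
rewrite /F asboolT//; split; rewrite /ball /= ltr_norml; lra.
Qed.

Lemma continuous_plane_measurable (f : R * R -> R) :
  continuous f -> measurable_fun setT f.
Proof.
move=> cf; apply: (measurability _ (measurable_realfun.RGenOInfty.measurableE R)).
move=> _ [_ [a ->] <-]; rewrite setTI; apply: open_plane_measurable.
move/continuousP : cf; apply; exact: interval_open.
Qed.

End PlaneMeasurability.

(** * The inner product of L^2 on the square: Cauchy-Schwarz, Bessel and Parseval *)

Section SquareL2.
Context {R : realType}.
Implicit Types f g h : R * R -> R.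
Local Notation mu := (@lebesgue_square R).

Lemma ae_square (P : R * R -> Prop) :
  (forall z, square z -> P z) -> {ae mu, forall z, P z}.
Proof.
move=> sP; exists (~` square); split.
- exact: measurableC (measurable_square).
- by rewrite /lebesgue_square /mrestr setICl measure0.
- by move=> z /= nP sz; apply: nP; exact: sP.
Qed.

Lemma lebesgue_square_fin : mu setT \is a fin_num.
Proof.
rewrite /lebesgue_square /mrestr setTI product_measure1E//=.
have lt11 : -1 < 1 :> R by lra.
by rewrite lebesgue_measure_itv/= lte_fin lt11 -EFinB -EFinM.
Qed.

Lemma square_bounded (f : R * R -> R) : continuous f ->
  exists M, forall z, square z -> `|f z| <= M.
Proof.
move=> cf.
have : compact (f @` (`[-1, 1]%classic `*` `[-1, 1]%classic)).
  apply: continuous_compact; first exact: continuous_subspaceT.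
  by apply: compact_setX; exact: segment_compact.
move=> /compact_bounded [M [_ /(_ (M + 1))]] H.
exists (M + 1) => -[x y] [/= Ix Iy]; apply: H; first by rewrite ltrDl.
by exists (x, y) => //; split => /=; exact: subset_itv_oo_cc.
Qed.

Lemma L2_measurable f : f \in L2_square -> measurable_fun setT f.
Proof. by rewrite /L2_square inE => /andP[]; rewrite inE. Qed.

Lemma L2_bounded f (M : R) : measurable_fun setT f ->
  (forall z, square z -> `|f z| <= M) -> f \in L2_square.
Proof.
move=> mf fM; rewrite /L2_square inE; apply/andP; split; rewrite inE//=.
rewrite /finite_norm unlock /= poweR_lty//.
have M0 : 0 <= M.
  apply: le_trans (fM (0, 0) _) => //.
  by split => /=; rewrite in_itv /=; lra.
apply: (@le_lt_trans _ _ (\int[mu]_x (M `^ 2)%:E)%E).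
  apply: ae_ge0_le_integral => //.
  - apply/measurable_realfun.measurable_EFinP.
    apply: (@measurableT_comp _ _ _ _ _ _ (@powR R ^~ 2)) => //.
    exact: measurableT_comp.
  - by move=> z _; rewrite lee_fin powR_ge0.
  - apply: ae_square => z /fM h _; rewrite lee_fin ge0_ler_powR//.
by rewrite integral_cst// ltey_eq fin_numM// lebesgue_square_fin.
Qed.

Lemma continuous_L2 f : continuous f -> f \in L2_square.
Proof.
move=> cf; have [M fM] := square_bounded cf.
by apply: L2_bounded fM; exact: continuous_plane_measurable.
Qed.

Let submodL2 := @Lfun_submod_closed _ _ R (@lebesgue_square R) _ (lee1n 2).

Lemma L2_0 : (fun=> 0) \in @L2_square R.
Proof. by case: submodL2. Qed.

Lemma L2_lin a f g : f \in L2_square -> g \in L2_square ->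
  (fun z => a * f z + g z) \in L2_square.
Proof. by case: submodL2 => _ /(_ a f g) h /h; apply. Qed.

Lemma eq_L2 f g : f =1 g -> f \in L2_square -> g \in L2_square.
Proof. by move=> /funext ->. Qed.

Lemma L2_scale a f : f \in L2_square -> (fun z => a * f z) \in L2_square.
Proof. by move=> /(L2_lin a)/(_ L2_0); apply: eq_L2 => z; rewrite addr0. Qed.

Lemma L2_add f g : f \in L2_square -> g \in L2_square ->
  (fun z => f z + g z) \in L2_square.
Proof. by move=> /(L2_lin 1)/[apply]; apply: eq_L2 => z; rewrite mul1r. Qed.

Lemma L2_sum (I : Type) (s : seq I) (F : I -> R * R -> R) :
  (forall i, F i \in L2_square) ->
  (fun z => \sum_(i <- s) F i z) \in L2_square.
Proof.
move=> FL; elim: s => [|i s IH].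
  by apply: eq_L2 L2_0 => z; rewrite big_nil.
by apply: eq_L2 (L2_add (FL i) IH) => z; rewrite big_cons.
Qed.

Lemma L2_integrable f g : f \in L2_square -> g \in L2_square ->
  mu.-integrable setT (EFin \o (fun z => f z * g z)).
Proof. by move=> Lf Lg; apply/Lfun1_integrable; exact: Lfun2_mul_Lfun1. Qed.

Lemma dotL2C f g : dotL2 f g = dotL2 g f.
Proof. by congr (Rintegral _ _ _); apply/funext => z; rewrite mulrC. Qed.

Lemma dotL2_lin a f g h : f \in L2_square -> g \in L2_square ->
  h \in L2_square ->
  dotL2 (fun z => a * f z + g z) h = a * dotL2 f h + dotL2 g h.
Proof.
move=> Lf Lg Lh; have If := L2_integrable Lf Lh; have Ig := L2_integrable Lg Lh.
rewrite /dotL2 -RintegralZl// -RintegralD//; last exact: integrableZl If.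
by congr (Rintegral _ _ _); apply/funext => z; rewrite mulrDl mulrA.
Qed.

Lemma dotL2_ge0 f : 0 <= dotL2 f f.
Proof. by apply: Rintegral_ge0 => z _; rewrite -expr2 sqr_ge0. Qed.

Lemma dotL2_0l f : dotL2 (fun=> 0) f = 0.
Proof.
rewrite /dotL2 (_ : (fun z => _) = cst 0) ?Rintegral_cst ?mul0r//.
by apply/funext => z; rewrite mul0r.
Qed.

Lemma eq_dotL2 f f' g g' : (forall z, f z = f' z) -> (forall z, g z = g' z) ->
  dotL2 f g = dotL2 f' g'.
Proof. by move=> /funext -> /funext ->. Qed.

Lemma dotL2_suml (I : Type) (s : seq I) (F : I -> R * R -> R) (c : I -> R) h :
  (forall i, F i \in L2_square) -> h \in L2_square ->
  dotL2 (fun z => \sum_(i <- s) c i * F i z) h =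
  \sum_(i <- s) c i * dotL2 (F i) h.
Proof.
move=> FL Lh; elim: s => [|i s IH].
  by rewrite big_nil -[RHS](dotL2_0l h); apply: eq_dotL2 => // z; rewrite big_nil.
have LS : (fun z => \sum_(j <- s) c j * F j z) \in L2_square.
  by apply: L2_sum => j; exact: L2_scale.
rewrite big_cons -IH -dotL2_lin//.
by apply: eq_dotL2 => // z; rewrite big_cons.
Qed.

Lemma dotL2_linr a f g h : f \in L2_square -> g \in L2_square ->
  h \in L2_square ->
  dotL2 h (fun z => a * f z + g z) = a * dotL2 h f + dotL2 h g.
Proof. by move=> *; rewrite dotL2C dotL2_lin// ![dotL2 _ h]dotL2C. Qed.

Lemma dotL2_quadratic t f g : f \in L2_square -> g \in L2_square ->
  0 <= dotL2 f f + 2 * t * dotL2 f g + t ^+ 2 * dotL2 g g.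
Proof.
move=> Lf Lg; have L := L2_lin t Lg Lf.
have := dotL2_ge0 (fun z => t * g z + f z).
rewrite dotL2_lin// !dotL2_linr// (dotL2C g f).
by lra.
Qed.

Lemma dotL2_cauchy_schwarz f g : f \in L2_square -> g \in L2_square ->
  dotL2 f g ^+ 2 <= dotL2 f f * dotL2 g g.
Proof.
move=> Lf Lg; have H t := dotL2_quadratic t Lf Lg.
have [g0|g0] := eqVneq (dotL2 g g) 0.
  have [->|fg0] := eqVneq (dotL2 f g) 0; first by rewrite expr0n/= g0 mulr0.
  (* Functions are not identified almost everywhere, so a null [g] is excluded by hand: at this t
     the quadratic expression would equal -1. *)
  have := H (- (dotL2 f f + 1) / (2 * dotL2 f g)); rewrite g0 mulr0 addr0.
  rewrite (_ : 2 * _ * _ = - (dotL2 f f + 1)); last by field.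
  by rewrite opprD addNKr oppr_ge0 ler10.
have gp : 0 < dotL2 g g by rewrite lt_def g0 dotL2_ge0.
move: (dotL2 f g) (dotL2 g g) (dotL2 f f) gp H {g0} => s t r t0 H.
have E : (r + 2 * (- s / t) * s + (- s / t) ^+ 2 * t) * t = r * t - s ^+ 2.
  by field; rewrite gt_eqF.
by rewrite -subr_ge0 -E pmulr_lge0.
Qed.

(** With [g] the orthogonal projection of [f], the sum is |g|^2 = (f, g), and the claim is |f - g|^2
    >= 0. *)
Lemma dotL2_bessel (I : finType) (b : I -> R * R -> R) (c : I -> R) f :
  (forall i, b i \in L2_square) -> f \in L2_square -> (forall i, 0 < c i) ->
  (forall i j, dotL2 (b i) (b j) = c i *+ (i == j)) ->
  \sum_i (dotL2 f (b i)) ^+ 2 / c i <= dotL2 f f.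
Proof.
move=> Lb Lf c0 bb; pose g z := \sum_i (dotL2 f (b i) / c i) * b i z.
have Lg : g \in L2_square by apply: L2_sum => i; exact: L2_scale.
have gb j : dotL2 g (b j) = dotL2 f (b j).
  rewrite dotL2_suml// (bigD1 j)//= bb eqxx divfK ?gt_eqF// big1 ?addr0// => i.
  by move=> /negbTE ij; rewrite bb ij mulr0.
have S h : h \in L2_square ->
    dotL2 h g = \sum_i dotL2 f (b i) / c i * dotL2 h (b i).
  move=> Lh; rewrite dotL2C dotL2_suml//.
  by apply: eq_bigr => i _; rewrite [dotL2 h _]dotL2C.
have gg : dotL2 g g = dotL2 f g.
  by rewrite !S//; apply: eq_bigr => i _; rewrite gb.
rewrite (_ : \sum_i _ = dotL2 f g); last first.
  by rewrite S//; apply: eq_bigr => i _; rewrite expr2 mulrAC.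
by have := dotL2_quadratic (-1) Lf Lg; rewrite gg; lra.
Qed.

Lemma dotL2_parseval (I : finType) (b : I -> R * R -> R) (c a : I -> R) :
  (forall i, b i \in L2_square) ->
  (forall i j, dotL2 (b i) (b j) = c i *+ (i == j)) ->
  dotL2 (fun z => \sum_i a i * b i z) (fun z => \sum_i a i * b i z) =
  \sum_i c i * a i ^+ 2.
Proof.
move=> Lb bb; set g := fun z => _.
have Lg : g \in L2_square by apply: L2_sum => i; exact: L2_scale.
rewrite dotL2_suml//; apply: eq_bigr => j _.
rewrite dotL2C dotL2_suml// (bigD1 j)//= bb eqxx big1 ?addr0.
  by rewrite mulr1n; ring.
by move=> i /negbTE ij; rewrite bb ij mulr0.
Qed.

End SquareL2.

(** * Fubini on the square and integrals of tensor products *)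

Section SquareFubini.
Context {R : realType}.
Local Notation mu := (@lebesgue_square R).
Local Notation lam := (@lebesgue_measure R).
Local Notation I11 := (`]-1, 1[%classic : set R).

(** Fubini applies to the product measure, to which the integral is transferred by setting the
    integrand to zero off the square. *)
Lemma square_integralE (f : R * R -> R) : continuous f ->
  (\int[mu]_z (f z)%:E = \int[lam \x lam]_z ((EFin \o f) \_ square) z)%E /\
  (lam \x lam)%E.-integrable setT ((EFin \o f) \_ square).
Proof.
move=> cf; split; last first.
  refine (proj1 (@integrable_mkcond _ _ R (lam \x lam)%E square (EFin \o f)
    measurable_square) _).
  apply: measurable_bounded_integrable.
  - exact: measurable_square.
  - have := @lebesgue_square_fin R.
    by rewrite /lebesgue_square /mrestr setTI => h; rewrite ltey_eq h.
  - exact: measurable_funTS (continuous_plane_measurable cf).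
  - have [M fM] := square_bounded cf.
    exists M; split; first exact: num_real.
    by move=> N MN z sz /=; exact: le_trans (fM _ sz) (ltW MN).
rewrite -integral_mkcond -[LHS]/(\int[mu]_z (EFin \o f) z)%E.
have m0 : mu (~` square) = 0%E.
  by rewrite /lebesgue_square /mrestr setICl measure0.
have If : mu.-integrable setT (EFin \o f).
  have := L2_integrable (continuous_L2 cf) (continuous_L2 (@cst_continuous _ _ (1 : R))).
  by apply: eq_integrable => // z _ /=; rewrite mulr1.
have -> := negligible_integral _ measurableT If m0; last first.
  exact: measurableC (@measurable_square R).
rewrite setDE setTI setCK; apply: eq_measure_integral => A mA As.
by rewrite /lebesgue_square /= /mrestr setIidl.
Qed.

Lemma square_fubini_xy (f : R * R -> R) : continuous f ->
  (\int[mu]_z (f z)%:E =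
   \int[lam]_(y in I11) \int[lam]_(x in I11) (f (x, y))%:E)%E.
Proof.
move=> cf; have [-> i] := square_integralE cf.
rewrite -(integral21_prod_meas1 i) [RHS]integral_mkcond.
apply: eq_integral => y _; rewrite /fubini_G patchE.
case: ifPn => yI.
  rewrite [RHS]integral_mkcond; apply: eq_integral => x _ /=.
  by rewrite !patchE /square in_setX /= yI andbT.
rewrite integral0_eq// => x _; rewrite patchE /square in_setX /=.
by rewrite (negbTE yI) andbF.
Qed.

Lemma square_fubini_yx (f : R * R -> R) : continuous f ->
  (\int[mu]_z (f z)%:E =
   \int[lam]_(x in I11) \int[lam]_(y in I11) (f (x, y))%:E)%E.
Proof.
move=> cf; have [-> i] := square_integralE cf.
rewrite -(integral12_prod_meas1 i) [RHS]integral_mkcond.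
apply: eq_integral => x _; rewrite /fubini_F patchE.
case: ifPn => xI.
  rewrite [RHS]integral_mkcond; apply: eq_integral => y _ /=.
  by rewrite !patchE /square in_setX /= xI.
rewrite integral0_eq// => y _; rewrite patchE /square in_setX /=.
by rewrite (negbTE xI).
Qed.

Lemma integral_derive_itv (f df : R -> R) :
  (forall x : R, is_derive x 1 f (df x)) -> continuous df ->
  (\int[lam]_(x in I11) (df x)%:E = (f 1 - f (-1))%:E)%E.
Proof.
move=> fdf cdf.
have mdf : measurable_fun setT df by exact: measurable_realfun.continuous_measurable_fun.
have cf : continuous f.
  by move=> x; apply/differentiable_continuous/derivable1_diffP; exact: ex_derive.
rewrite -(@integral_itv_bndoo _ _ _ _ true false); last first.
  by apply/measurable_realfun.measurable_EFinP; exact: measurable_funTS.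
rewrite (@continuous_FTC2 _ _ f) ?EFinB//.
- exact: continuous_subspaceT.
- split=> [x _| |]; first exact: ex_derive.
    exact: (cvg_at_right_filter (cf _)).
  exact: (cvg_at_left_filter (cf _)).
- by move=> x _; rewrite derive1E derive_val.
Qed.

Lemma pint_integral (p : {poly R}) :
  (\int[lam]_(x in I11) (p.[x])%:E = (pint p)%:E)%E.
Proof.
have dp (x : R) : is_derive x 1 (horner (primitive p)) p.[x].
  by have := is_derive_poly (primitive p) x; rewrite deriv_primitive.
exact: (integral_derive_itv dp (@continuous_horner _ p)).
Qed.

Definition tensor (p q : {poly R}) (z : R * R) : R := p.[z.1] * q.[z.2].

Lemma continuous_tensor p q : continuous (tensor p q).
Proof.
move=> z; apply: cvgM.
  by apply: continuous_comp; [exact: cvg_fst|exact: continuous_horner].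
by apply: continuous_comp; [exact: cvg_snd|exact: continuous_horner].
Qed.

Lemma tensor_L2 p q : tensor p q \in L2_square.
Proof. exact: continuous_L2 (@continuous_tensor p q). Qed.

Lemma dotL2_tensor p q r s :
  dotL2 (tensor p q) (tensor r s) = pint (p * r) * pint (q * s).
Proof.
rewrite /dotL2 /Rintegral.
have -> : (fun z => (tensor p q z * tensor r s z)%:E) =
          (fun z => (tensor (p * r) (q * s) z)%:E).
  by apply/funext => z; rewrite /tensor !hornerM mulrACA.
rewrite (square_fubini_xy (@continuous_tensor _ _)).
have -> : (\int[lam]_(y in I11) \int[lam]_(x in I11)
    (tensor (p * r) (q * s) (x, y))%:E =
    \int[lam]_(y in I11) ((pint (p * r) *: (q * s)).[y])%:E)%E.
  apply: eq_integral => y _.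
  transitivity (\int[lam]_(x in I11) (((q * s).[y] *: (p * r)).[x])%:E)%E.
    by apply: eq_integral => x _; rewrite /tensor hornerZ mulrC.
  by rewrite pint_integral linearZ /= hornerZ mulrC.
by rewrite pint_integral linearZ.
Qed.

End SquareFubini.

(** * Partial derivatives and integration by parts *)

Section PartialDerivatives.
Context {R : realType}.
Implicit Types f : R * R -> R.

Lemma growth_rate_x f z : (fun h : R => h^-1 *: (f (h *: (1, 0) + z) - f z)) =
  (fun h => h^-1 *: (f (h *: 1 + z.1, z.2) - f (z.1, z.2))).
Proof.
apply/funext => h; case: z => x y; congr (_ *: (f _ - _)).
by congr pair; rewrite /= scaler0 add0r.
Qed.

Lemma growth_rate_y f z : (fun h : R => h^-1 *: (f (h *: (0, 1) + z) - f z)) =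
  (fun h => h^-1 *: (f (z.1, h *: 1 + z.2) - f (z.1, z.2))).
Proof.
apply/funext => h; case: z => x y; congr (_ *: (f _ - _)).
by congr pair; rewrite /= scaler0 add0r.
Qed.

Lemma is_derive_x f (z : R * R) (l : R) :
  is_derive z (1, 0) f l <-> is_derive z.1 1 (fun t => f (t, z.2)) l.
Proof.
by split=> -[d e]; split; move: d e; rewrite /derivable /derive growth_rate_x.
Qed.

Lemma is_derive_y f (z : R * R) (l : R) :
  is_derive z (0, 1) f l <-> is_derive z.2 1 (fun t => f (z.1, t)) l.
Proof.
by split=> -[d e]; split; move: d e; rewrite /derivable /derive growth_rate_y.
Qed.
End PartialDerivatives.

Section PartsOnSquare.
Context {R : realType}.
Implicit Types f g phi : R * R -> R.
Local Notation mu := (@lebesgue_square R).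

Definition C1_x f := [/\ continuous f, forall z, derivable f z (1, 0) &
  continuous (partial_x f)].
Definition C1_y f := [/\ continuous f, forall z, derivable f z (0, 1) &
  continuous (partial_y f)].

Lemma section_x_continuous f (y : R) : continuous f ->
  continuous (fun t => f (t, y)).
Proof.
move=> cf t; apply: (@continuous_comp _ _ _ (fun t => (t, y)) f); last exact: cf.
refine (@cvg_pair _ _ _ (nbhs t) (nbhs t) (nbhs y) _ _ _ id (fun=> y) _ _).
  exact: cvg_id.
exact: cvg_cst.
Qed.

Lemma section_y_continuous f (x : R) : continuous f ->
  continuous (fun t => f (x, t)).
Proof.
move=> cf t; apply: (@continuous_comp _ _ _ (fun t => (x, t)) f); last exact: cf.
refine (@cvg_pair _ _ _ (nbhs t) (nbhs x) (nbhs t) _ _ _ (fun=> x) id _ _).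
  exact: cvg_cst.
exact: cvg_id.
Qed.

Lemma integral_partial_x f : C1_x f -> (forall z, ~ square z -> f z = 0) ->
  (\int[mu]_z (partial_x f z)%:E = 0)%E.
Proof.
move=> [cf df cdf] f0; rewrite (square_fubini_xy cdf).
apply: integral0_eq => y _.
have dfy (x : R) : is_derive x 1 (fun t => f (t, y)) (partial_x f (x, y)).
  by have /is_derive_x := derivableP (df (x, y)).
rewrite (integral_derive_itv dfy (section_x_continuous cdf)).
by rewrite !f0 ?subrr// => -[/=]; rewrite in_itv /= ltxx ?andbF.
Qed.

Lemma integral_partial_y f : C1_y f -> (forall z, ~ square z -> f z = 0) ->
  (\int[mu]_z (partial_y f z)%:E = 0)%E.
Proof.
move=> [cf df cdf] f0; rewrite (square_fubini_yx cdf).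
apply: integral0_eq => x _.
have dfx (y : R) : is_derive y 1 (fun t => f (x, t)) (partial_y f (x, y)).
  by have /is_derive_y := derivableP (df (x, y)).
rewrite (integral_derive_itv dfx (section_y_continuous cdf)).
by rewrite !f0 ?subrr// => -[_ /=]; rewrite in_itv /= ltxx ?andbF.
Qed.

Lemma test_function_out phi z : test_function phi -> ~ square z -> phi z = 0.
Proof.
move=> [_ _ ssq] nz; apply/eqP; apply: contra_notT nz => pz.
by apply: ssq; exact: subset_closure.
Qed.

Lemma test_function_C1x phi : test_function phi -> C1_x phi.
Proof. by move=> [/(_ 1%N) [c d c' _ _] _ _]; split. Qed.

Lemma test_function_C1y phi : test_function phi -> C1_y phi.
Proof. by move=> [/(_ 1%N) [c _ _ d c'] _ _]; split. Qed.

(** The integral of the x-derivative of f phi vanishes because phi does off the square; [f] itself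
    is free on the boundary. *)
Lemma parts_x f phi : C1_x f -> test_function phi ->
  dotL2 f (partial_x phi) = - dotL2 (partial_x f) phi.
Proof.
move=> Cf tphi; have [cf df cdf] := Cf.
have [cp dp cdp] := test_function_C1x tphi.
have dfp (z : R * R) : is_derive z (1, 0) (f * phi)
    (f z * partial_x phi z + partial_x f z * phi z).
  have := is_deriveM (derivableP (df z)) (derivableP (dp z)).
  by rewrite /GRing.scale/= [phi z * _]mulrC.
have E : partial_x (f * phi) =
    (fun z => f z * partial_x phi z + partial_x f z * phi z).
  by apply/funext => z; rewrite /partial_x derive_val.
apply/eqP; rewrite -addr_eq0; apply/eqP.
rewrite /dotL2 -RintegralD//; last 2 first.
- by apply: L2_integrable; exact: continuous_L2.
- by apply: L2_integrable; exact: continuous_L2.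
have Cfp : C1_x (f * phi).
  split=> [z|z|].
  - by apply: cvgM; [exact: cf|exact: cp].
  - exact: ex_derive.
  - by rewrite E => z; apply: cvgD; apply: cvgM;
      [exact: cf|exact: cdp|exact: cdf|exact: cp].
have fp0 z : ~ square z -> (f * phi) z = 0.
  by move=> nz; rewrite /GRing.mul /= (test_function_out tphi nz) mulr0.
by have := congr1 fine (integral_partial_x Cfp fp0); rewrite E.
Qed.

Lemma parts_y f phi : C1_y f -> test_function phi ->
  dotL2 f (partial_y phi) = - dotL2 (partial_y f) phi.
Proof.
move=> Cf tphi; have [cf df cdf] := Cf.
have [cp dp cdp] := test_function_C1y tphi.
have dfp (z : R * R) : is_derive z (0, 1) (f * phi)
    (f z * partial_y phi z + partial_y f z * phi z).
  have := is_deriveM (derivableP (df z)) (derivableP (dp z)).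
  by rewrite /GRing.scale/= [phi z * _]mulrC.
have E : partial_y (f * phi) =
    (fun z => f z * partial_y phi z + partial_y f z * phi z).
  by apply/funext => z; rewrite /partial_y derive_val.
apply/eqP; rewrite -addr_eq0; apply/eqP.
rewrite /dotL2 -RintegralD//; last 2 first.
- by apply: L2_integrable; exact: continuous_L2.
- by apply: L2_integrable; exact: continuous_L2.
have Cfp : C1_y (f * phi).
  split=> [z|z|].
  - by apply: cvgM; [exact: cf|exact: cp].
  - exact: ex_derive.
  - by rewrite E => z; apply: cvgD; apply: cvgM;
      [exact: cf|exact: cdp|exact: cdf|exact: cp].
have fp0 z : ~ square z -> (f * phi) z = 0.
  by move=> nz; rewrite /GRing.mul /= (test_function_out tphi nz) mulr0.
by have := congr1 fine (integral_partial_y Cfp fp0); rewrite E.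
Qed.
End PartsOnSquare.

(** * Smooth cutoffs *)

Section FlatFunctions.
Context {R : realType}.
Implicit Types (k n : nat) (t x : R).

(** The functions t^(-k) e^(-1/t), extended by 0. Their span is closed under differentiation, so a
    single derivative formula gives smoothness of every order. *)
Definition flat k t : R := if 0 < t then t^-1 ^+ k * expR (- t^-1) else 0.

Lemma flat_le0 k t : t <= 0 -> flat k t = 0.
Proof. by rewrite /flat ltNge => ->. Qed.

Lemma flat_ge0 k t : 0 <= flat k t.
Proof.
rewrite /flat; case: ltP => // t0.
by rewrite mulr_ge0 ?expR_ge0// exprn_ge0// invr_ge0 ltW.
Qed.

Lemma flatS k t : flat k t = t * flat k.+1 t.
Proof.
rewrite /flat; case: ltP => [t0|]; last by rewrite mulr0.
by rewrite exprS !mulrA divff ?gt_eqF// mul1r.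
Qed.

Lemma flat_le_fact k t : flat k t <= k`!%:R.
Proof.
rewrite /flat; case: ltP => // t0; rewrite expRN ler_pdivrMr ?expR_gt0//.
have s0 : 0 <= t^-1 by rewrite invr_ge0 ltW.
case: k => [|k].
  by rewrite expr0 mul1r -expR0 ler_expR.
have := expR_ge1Dxn k s0.
rewrite -(ler_pM2l (_ : 0 < (k.+1)`!%:R)) ?ltr0n ?fact_gt0//.
apply: le_trans; rewrite mulrDr mulr1 mulrCA divff ?mulr1 ?lerDr//.
Qed.

Lemma flat_norm_le k t : `|flat k t| <= k`!%:R.
Proof. by rewrite ger0_norm ?flat_ge0 ?flat_le_fact. Qed.

Lemma is_derive_flat k t :
  is_derive t 1 (flat k) (flat k.+2 t - k%:R * flat k.+1 t).
Proof.
have [t0|t0|->] := ltgtP t 0.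
- rewrite !flat_le0 ?(ltW t0)// mulr0 subrr.
  apply: (@near_eq_is_derive _ _ _ (cst 0)).
  near=> s; rewrite /= flat_le0//; apply/ltW.
  by near: s; exact: (lt_nbhsl t0).
- pose g s : R := s^-1 ^+ k * expR (- s^-1).
  apply: (@near_eq_is_derive _ _ _ g).
    near=> s; rewrite /g /flat ifT//.
    by near: s; exact: (lt_nbhsr t0).
  have tn0 : t != 0 by rewrite gt_eqF.
  have dV : is_derive t 1 (fun s : R => s^-1) (- t^-1 ^+ 2).
    have := @is_deriveV R id t 1 1 tn0 (is_derive_id t 1).
    by rewrite /GRing.scale/= mulr1 exprVn.
  have dX := is_deriveX k dV.
  have dN := is_deriveN dV.
  have dE := @is_derive1_comp R expR (fun s : R => - s^-1) t _ _
    (is_derive_expR (- t^-1)) dN.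
  have := is_deriveM dX dE.
  rewrite /GRing.scale/=.
  set l := (X in is_derive _ _ _ X -> _).
  set r := (X in _ -> is_derive _ _ _ X).
  suff -> : l = r.
    congr (is_derive _ _ _ _); apply/funext => s.
    by rewrite /g /GRing.mul /= exprfctE.
  rewrite /l /r /flat t0 opprK exprfctE; case: k {dX dE l r g} => [|k] /=.
    by rewrite !expr0; ring.
  by rewrite !exprS; ring.
(* At 0 the slope is [flat k.+1], by [flatS]; applying [flatS] again bounds it by |s| (k+2)!, so it
   tends to 0. *)
- rewrite !flat_le0// mulr0 subrr; apply/is_derive1_caratheodory.
  exists (flat k.+1); split => [s||]; last by rewrite flat_le0.
    by rewrite (flat_le0 k (lexx 0)) !subr0 flatS mulrC.
  apply/cvgrPdist_le => e e0; rewrite (flat_le0 _ (lexx 0)).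
  have M0 : 0 < k.+2`!%:R :> R by rewrite ltr0n fact_gt0.
  near=> s; rewrite sub0r normrN flatS normrM.
  apply: (@le_trans _ _ (`|s| * k.+2`!%:R)).
    by rewrite ler_wpM2l// flat_norm_le.
  rewrite -ler_pdivlMr//; near: s.
  apply/nbhs_ballP; exists (e / k.+2`!%:R); first by rewrite /= divr_gt0.
  by move=> s /=; rewrite /ball/= sub0r normrN => /ltW.
Unshelve. all: by end_near. Qed.

Lemma flatS_le k t : 0 < t -> flat k.+1 t <= k`!%:R / t.
Proof. by move=> t0; rewrite ler_pdivlMr// mulrC -flatS flat_le_fact. Qed.

Lemma flat0_ge t : 0 < t -> 1 - t^-1 <= flat 0 t <= 1.
Proof.
move=> t0; have := flat_le_fact 0 t; rewrite /flat t0 expr0 mul1r fact0 => ->.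
by rewrite expR_ge1Dx.
Qed.

End FlatFunctions.

Section CutoffFunctions.
Context {R : realType}.
Implicit Types (k n : nat) (x t : R) (p : {poly R}).

(** It is nonpositive near the endpoints, which gives compact support to [flat_cut], and tends to
    infinity inside, where [flat_cut n 0] tends to 1. *)
Definition cutoff_arg n : {poly R} := n%:R *: (1 - 'X^2) - 1.

Lemma cutoff_argE n x : (cutoff_arg n).[x] = n%:R * (1 - x ^+ 2) - 1.
Proof. by rewrite /cutoff_arg !hornerE. Qed.

Lemma deriv_cutoff_arg n : (cutoff_arg n)^`() = (- (2 * n%:R)) *: 'X.
Proof.
rewrite /cutoff_arg derivB derivZ derivB derivXn !derivC subr0 sub0r /=.
by rewrite expr1 scalerN -scalerMnr scalerMnl -scaleNr -[_ *+ 2]mulr_natl.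
Qed.

Definition flat_cut n k x : R := flat k (cutoff_arg n).[x].

Lemma is_derive_flat_cut n k x : is_derive x 1 (flat_cut n k)
  ((flat_cut n k.+2 x - k%:R * flat_cut n k.+1 x) * (cutoff_arg n)^`().[x]).
Proof.
exact: (is_derive1_comp (is_derive_flat k _) (is_derive_poly (cutoff_arg n) x)).
Qed.

(** A class closed under differentiation whose members, for fixed n, all vanish outside the same
    compact subinterval. *)
Inductive smooth_cut n : (R -> R) -> Prop :=
| smooth_cut_base p k : smooth_cut n (fun x => p.[x] * flat_cut n k x)
| smooth_cut_add f g : smooth_cut n f -> smooth_cut n g ->
    smooth_cut n (fun x => f x + g x).

Lemma smooth_cut_derive n f : smooth_cut n f ->
  exists2 df, smooth_cut n df & forall x, is_derive x 1 f (df x).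
Proof.
elim=> [p k|{}f g _ [df sdf fdf] _ [dg sdg gdg]]; last first.
  exists (fun x => df x + dg x); first exact: smooth_cut_add.
  by move=> x; exact: is_deriveD.
exists (fun x => p^`().[x] * flat_cut n k x +
  ((p * (cutoff_arg n)^`()).[x] * flat_cut n k.+2 x +
  ((- k%:R) *: (p * (cutoff_arg n)^`())).[x] * flat_cut n k.+1 x)).
  by do 2![apply: smooth_cut_add; first exact: smooth_cut_base];
    exact: smooth_cut_base.
move=> x.
have := is_deriveM (is_derive_poly p x) (is_derive_flat_cut n k x).
set l := (X in is_derive _ _ _ X -> _); set r := (X in _ -> is_derive _ _ _ X).
suff -> : l = r by [].
by rewrite /l /r /GRing.scale/= hornerZ !hornerM; ring.
Qed.

Lemma smooth_cut_out n f x : smooth_cut n f -> n%:R * (1 - x ^+ 2) <= 1 ->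
  f x = 0.
Proof.
move=> sf nx; elim: sf => [p k|{}f g _ f0 _ g0].
  by rewrite /flat_cut flat_le0 ?mulr0// cutoff_argE subr_le0.
by rewrite f0 g0 addr0.
Qed.

Inductive smooth_cut2 n : (R * R -> R) -> Prop :=
| smooth_cut2_base f g : smooth_cut n f -> smooth_cut n g ->
    smooth_cut2 n (fun z => f z.1 * g z.2)
| smooth_cut2_add f g : smooth_cut2 n f -> smooth_cut2 n g ->
    smooth_cut2 n (fun z => f z + g z).

Lemma is_deriveZl (f : R -> R) x (df c : R) :
  is_derive x 1 f df -> is_derive x 1 (fun t => f t * c) (df * c).
Proof.
move=> fdf; have := is_deriveM fdf (is_derive_cst c x 1).
by rewrite /GRing.scale/= mulr0 add0r [c * df]mulrC.
Qed.

Lemma is_deriveZr (f : R -> R) x (df c : R) :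
  is_derive x 1 f df -> is_derive x 1 (fun t => c * f t) (c * df).
Proof.
move=> fdf; suff -> : (fun t => c * f t) = (fun t => f t * c).
  by rewrite mulrC; exact: is_deriveZl.
by apply/funext => t; rewrite mulrC.
Qed.

Lemma smooth_cut2_x n f : smooth_cut2 n f ->
  exists2 df, smooth_cut2 n df & forall z : R * R, is_derive z (1, 0) f (df z).
Proof.
elim=> [f1 f2 /smooth_cut_derive[df sdf fdf] s2|
        f1 f2 _ [d1 sd1 f1d] _ [d2 sd2 f2d]]; last first.
  exists (fun z => d1 z + d2 z); first exact: smooth_cut2_add.
  by move=> z; exact: is_deriveD.
exists (fun z => df z.1 * f2 z.2); first exact: smooth_cut2_base.
by move=> z; apply/is_derive_x; exact: (is_deriveZl (f2 z.2) (fdf z.1)).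
Qed.

Lemma smooth_cut2_y n f : smooth_cut2 n f ->
  exists2 df, smooth_cut2 n df & forall z : R * R, is_derive z (0, 1) f (df z).
Proof.
elim=> [f1 f2 s1 /smooth_cut_derive[df sdf fdf]|
        f1 f2 _ [d1 sd1 f1d] _ [d2 sd2 f2d]]; last first.
  exists (fun z => d1 z + d2 z); first exact: smooth_cut2_add.
  by move=> z; exact: is_deriveD.
exists (fun z => f1 z.1 * df z.2); first exact: smooth_cut2_base.
by move=> z; apply/is_derive_y; exact: (is_deriveZr (f1 z.1) (fdf z.2)).
Qed.

Lemma smooth_cut_continuous n f : smooth_cut n f -> continuous f.
Proof.
move=> /smooth_cut_derive[df _ fdf] x.
by apply/differentiable_continuous/derivable1_diffP; exact: ex_derive.
Qed.

Lemma smooth_cut2_continuous n f : smooth_cut2 n f -> continuous f.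
Proof.
elim=> [f1 f2 s1 s2|f1 f2 _ c1 _ c2] z.
  apply: cvgM.
    by apply: continuous_comp; [exact: cvg_fst|exact: (smooth_cut_continuous s1)].
  by apply: continuous_comp; [exact: cvg_snd|exact: (smooth_cut_continuous s2)].
by apply: cvgD; [exact: c1|exact: c2].
Qed.

Lemma smooth_cut2_Ck n f k : smooth_cut2 n f -> Ck k f.
Proof.
elim: k f => [|k IH] f sf /=; first exact: smooth_cut2_continuous sf.
have [dx sx fx] := smooth_cut2_x sf; have [dy sy fy] := smooth_cut2_y sf.
split=> [|z||z|].
- exact: smooth_cut2_continuous sf.
- exact: ex_derive.
- suff -> : partial_x f = dx by exact: IH.
  by apply/funext => z; rewrite /partial_x derive_val.
- exact: ex_derive.
- suff -> : partial_y f = dy by exact: IH.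
  by apply/funext => z; rewrite /partial_y derive_val.
Qed.

Lemma smooth_cut2_out n f (z : R * R) : smooth_cut2 n f -> f z != 0 ->
  1 <= n%:R * (1 - z.1 ^+ 2) /\ 1 <= n%:R * (1 - z.2 ^+ 2).
Proof.
move=> sf; suff H : (n%:R * (1 - z.1 ^+ 2) <= 1) || (n%:R * (1 - z.2 ^+ 2) <= 1)
    -> f z = 0.
  move=> fz; split; rewrite leNgt; apply: contra fz => /ltW h;
    by rewrite H ?eqxx// h ?orbT.
elim: sf => [f1 f2 s1 s2|f1 f2 _ c1 _ c2].
  by move=> /orP[] h; rewrite (smooth_cut_out _ h)// ?mul0r ?mulr0.
by move=> h; rewrite c1// c2// addr0.
Qed.

Lemma smooth_cut2_test n f : smooth_cut2 n f -> test_function f.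
Proof.
move=> sf; pose g x : R := n%:R * (1 - x ^+ 2).
have cg : continuous g.
  move=> x; rewrite /g; suff -> : (fun x => n%:R * (1 - x ^+ 2)) =
      horner (n%:R *: (1 - 'X^2) : {poly R}) by exact: continuous_horner.
  by apply/funext => t; rewrite !hornerE.
(* Being closed, this set contains the closed support as soon as it contains the nonzero points; it
   still lies in the open square. *)
pose K := [set z : R * R | 1 <= g z.1] `&` [set z : R * R | 1 <= g z.2].
have clK : closed K.
  apply: closedI.
  - apply: (@closed_comp _ _ (g \o fst) [set y : R | 1 <= y]).
      move=> z _; apply: continuous_comp; [exact: cvg_fst|exact: cg].
    exact: closed_ge.
  - apply: (@closed_comp _ _ (g \o snd) [set y : R | 1 <= y]).
      move=> z _; apply: continuous_comp; [exact: cvg_snd|exact: cg].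
    exact: closed_ge.
have inI x : 1 <= g x -> x \in `]-1, 1[.
  rewrite /g in_itv /= => h; have : 0 < 1 - x ^+ 2.
    rewrite ltNge; apply/negP => h'.
    by have := ler_wpM2l (ler0n R n) h'; rewrite mulr0; lra.
  by move=> h'; apply/andP; split; nra.
have Ks : K `<=` square by move=> z [/= /inI ? /inI ?]; split.
have sK : closed_support f `<=` K.
  rewrite /closed_support (closure_id K).1//; apply: closure_subset.
  by move=> z /= /(smooth_cut2_out sf)[].
split; first by move=> k; exact: smooth_cut2_Ck sf.
- apply: (subclosed_compact _
    (compact_setX (@segment_compact R (-1) 1) (@segment_compact R (-1) 1))).
    exact: closed_closure.
  by move=> z /sK /Ks [/= h1 h2]; split => /=; exact: subset_itv_oo_cc.
- exact: subset_trans sK Ks.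
Qed.

End CutoffFunctions.

(** * Approximation of bubbles by test functions *)

Section BoundedConvergence.
Context {R : realType}.
Implicit Types (u v : nat -> R * R -> R) (f g l m : R * R -> R).
Local Notation mu := (@lebesgue_square R).

(** Uniformly bounded pointwise convergence: stable under sums and products, and sufficient for
    dominated convergence on a set of finite measure. *)
Definition bounded_cvg u l :=
  (exists M, forall n z, square z -> `|u n z| <= M) /\
  (forall z, square z -> u n z @[n --> \oo] --> l z).

Lemma bounded_cvgD u v l m : bounded_cvg u l -> bounded_cvg v m ->
  bounded_cvg (fun n z => u n z + v n z) (fun z => l z + m z).
Proof.
move=> [[M uM] ul] [[N vN] vm]; split.
  exists (M + N) => n z sz.
  exact: le_trans (ler_normD _ _) (lerD (uM n z sz) (vN n z sz)).
by move=> z sz; apply: cvgD; [exact: ul|exact: vm].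
Qed.

Lemma bounded_cvgM u v l m : bounded_cvg u l -> bounded_cvg v m ->
  bounded_cvg (fun n z => u n z * v n z) (fun z => l z * m z).
Proof.
move=> [[M uM] ul] [[N vN] vm]; split.
  by exists (M * N) => n z sz; rewrite normrM ler_pM// ?uM ?vN.
by move=> z sz; apply: cvgM; [exact: ul|exact: vm].
Qed.

Lemma bounded_cvg_cst f : continuous f -> bounded_cvg (fun=> f) f.
Proof.
move=> cf; split; last by move=> z _; exact: cvg_cst.
by have [M fM] := square_bounded cf; exists M.
Qed.

Lemma bounded_cvg_ext u v l m : (forall n z, u n z = v n z) ->
  (forall z, l z = m z) -> bounded_cvg u l -> bounded_cvg v m.
Proof. by move=> uv /funext <-; rewrite (funext (fun n => funext (uv n))). Qed.

Lemma bounded_cvg_sum (I : Type) (s : seq I) (u : I -> nat -> R * R -> R)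
    (l : I -> R * R -> R) : (forall i, bounded_cvg (u i) (l i)) ->
  bounded_cvg (fun n z => \sum_(i <- s) u i n z) (fun z => \sum_(i <- s) l i z).
Proof.
move=> ul; elim: s => [|i s IH].
  apply: (@bounded_cvg_ext (fun _ => fun=> 0) _ (fun=> 0)); last first.
  - exact: bounded_cvg_cst (@cst_continuous _ _ (0 : R)).
  - by move=> z; rewrite big_nil.
  - by move=> n z; rewrite big_nil.
by apply: bounded_cvg_ext (bounded_cvgD (ul i) IH) => [n z|z]; rewrite big_cons.
Qed.

Lemma bounded_cvg_sqrB u f : continuous f -> bounded_cvg u f ->
  bounded_cvg (fun n z => (f z - u n z) ^+ 2) (fun=> 0).
Proof.
move=> cf uf; have c1 : continuous ((fun=> -1) : R * R -> R).
  exact: cst_continuous.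
have H := bounded_cvgD (bounded_cvg_cst cf) (bounded_cvgM (bounded_cvg_cst c1) uf).
apply: bounded_cvg_ext (bounded_cvgM H H) => [n z|z].
  by rewrite mulN1r expr2.
by rewrite mulN1r subrr mulr0.
Qed.

Lemma bounded_cvg_integral u : (forall n, continuous (u n)) -> bounded_cvg u (fun=> 0) ->
  (\int[mu]_z (u n z)%:E)%E @[n --> \oo] --> 0%E.
Proof.
move=> cu [[M uM] ul].
have [] := @dominated_convergence _ _ _ mu setT measurableT
  (fun n => EFin \o u n) (cst 0%E) (cst M%:E).
- move=> n; apply/measurable_realfun.measurable_EFinP.
  exact: continuous_plane_measurable.
- exact: measurable_cst.
- apply: ae_square => z sz _; apply: cvg_EFin; last exact: ul.
  by near=> n.
- apply/integrableP; split; first exact: measurable_cst.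
  by rewrite integral_cst//= ltey_eq fin_numM// lebesgue_square_fin.
- by apply: ae_square => z sz n _; rewrite /= lee_fin uM.
by move=> _ _; rewrite integral_cst// mul0e.
Unshelve. all: by end_near. Qed.

End BoundedConvergence.

Section BubbleApproximation.
Context {R : realType}.
Implicit Types (k n : nat) (x : R).
Local Notation mu := (@lebesgue_square R).

Lemma cutoff_arg_large x (A : R) : x \in `]-1, 1[ ->
  \forall n \near \oo, A <= (cutoff_arg n).[x].
Proof.
rewrite in_itv /= => /andP[x1 x2].
have a0 : 0 < 1 - x ^+ 2 by nra.
near=> n; rewrite cutoff_argE lerBrDr -ler_pdivrMr//.
near: n; exact: nbhs_infty_ger.
Unshelve. all: by end_near. Qed.

Lemma cvg_flat_cut0 x : x \in `]-1, 1[ ->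
  flat_cut n 0 x @[n --> \oo] --> (1 : R).
Proof.
move=> xI; apply/cvgrPdist_le => e e0; near=> n.
have : Num.max 1 e^-1 <= (cutoff_arg n).[x].
  by near: n; exact: cutoff_arg_large.
rewrite ge_max /flat_cut; set s := (cutoff_arg n).[x] => /andP[s1 se].
have s0 : 0 < s by rewrite (lt_le_trans ltr01).
have /andP[h1 h2] := flat0_ge s0.
have : s^-1 <= e by rewrite -(invrK e) lef_pV2 ?posrE ?invr_gt0.
by rewrite ger0_norm ?subr_ge0//; lra.
Unshelve. all: by end_near. Qed.

Lemma cvg_flat_cutS k x : x \in `]-1, 1[ ->
  flat_cut n k.+1 x @[n --> \oo] --> (0 : R).
Proof.
move=> xI; apply/cvgrPdist_le => e e0; near=> n.
have : Num.max 1 (k`!%:R / e) <= (cutoff_arg n).[x].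
  by near: n; exact: cutoff_arg_large.
rewrite ge_max /flat_cut; set s := (cutoff_arg n).[x] => /andP[s1 se].
have s0 : 0 < s by rewrite (lt_le_trans ltr01).
rewrite sub0r normrN ger0_norm ?flat_ge0//.
apply: le_trans (flatS_le k s0) _.
by rewrite ler_pdivrMr// mulrC -ler_pdivrMr.
Unshelve. all: by end_near. Qed.

(* [pi] stands for either coordinate. *)
Section Coordinate.
Variable pi : R * R -> R.
Hypothesis cpi : continuous pi.
Hypothesis piI : forall z, square z -> pi z \in `]-1, 1[.

Lemma bounded_cvg_flat_cut k :
  bounded_cvg (fun n z => flat_cut n k (pi z)) (fun=> (k == 0%N)%:R).
Proof.
split.
  by exists k`!%:R => n z _; exact: flat_norm_le.
move=> z /piI; case: k => [|k] /=; first exact: cvg_flat_cut0.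
exact: cvg_flat_cutS.
Qed.

Lemma bounded_cvg_poly (p : {poly R}) :
  bounded_cvg (fun=> fun z => p.[pi z]) (fun z => p.[pi z]).
Proof.
apply: bounded_cvg_cst => z.
by apply: continuous_comp; [exact: cpi|exact: continuous_horner].
Qed.

Definition cut_bubble n k x : R := (bubble k).[x] * flat_cut n 0 x.

Lemma bounded_cvg_cut_bubble k :
  bounded_cvg (fun n z => cut_bubble n k (pi z)) (fun z => (bubble k).[pi z]).
Proof.
have H := bounded_cvgM (bounded_cvg_poly (bubble k)) (bounded_cvg_flat_cut 0).
by apply: bounded_cvg_ext H => // z /=; rewrite mulr1.
Qed.

Lemma cut_bubble_derive k : exists2 d : nat -> R -> R,
  (forall n x, is_derive x 1 (cut_bubble n k) (d n x)) &
  bounded_cvg (fun n z => d n (pi z)) (fun z => (leg k.+1).[pi z]).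
Proof.
have [r Er] := @bubble_div R k.
(* With s the argument of the cutoff, s + 1 = n (1 - x^2): the factor
   1 - x^2 of the bubble compensates the derivative of s, of size n. *)
exists (fun n x => (leg k.+1).[x] * flat_cut n 0 x +
  (2%:R *: 'X * r).[x] * (flat_cut n 1 x + flat_cut n 2 x)).
  move=> n x; have := is_deriveM (is_derive_poly (bubble k) x)
    (is_derive_flat_cut n 0 x).
  set l := (X in is_derive _ _ _ X -> _); set d := (X in _ -> is_derive _ _ _ X).
  suff -> : l = d by [].
  rewrite /l /d /GRing.scale/= deriv_bubble mul0r subr0 Er.
  (* Hence (s + 1) [flat_cut n 2] is [flat_cut n 1] + [flat_cut n 2], bounded in n and tending to
     0. *)
  have -> : flat_cut n 1 x = (cutoff_arg n).[x] * flat_cut n 2 x.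
    by rewrite /flat_cut flatS.
  rewrite deriv_cutoff_arg.
  rewrite cutoff_argE [(_ * r).[x]]hornerM; set b := (leg k.+1).[x].
  by rewrite !hornerE /=; ring.
have H0 := bounded_cvg_flat_cut 0.
have H12 := bounded_cvgD (bounded_cvg_flat_cut 1) (bounded_cvg_flat_cut 2).
have H := bounded_cvgD (bounded_cvgM (bounded_cvg_poly (leg k.+1)) H0)
  (bounded_cvgM (bounded_cvg_poly (2%:R *: 'X * r)) H12).
apply: bounded_cvg_ext H; first by [].
by move=> z /=; rewrite addr0 mulr0 addr0 mulr1.
Qed.

End Coordinate.
End BubbleApproximation.

Section BubbleSums.
Context {R : realType}.
Local Notation mu := (@lebesgue_square R).
Implicit Types (p q : {poly R}) (z : R * R) (n : nat).

Lemma is_derive_tensor_x p q z : is_derive z (1, 0) (tensor p q) (tensor p^`() q z).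
Proof.
by apply/is_derive_x; exact: (is_deriveZl q.[z.2] (is_derive_poly p z.1)).
Qed.

Lemma is_derive_tensor_y p q z : is_derive z (0, 1) (tensor p q) (tensor p q^`() z).
Proof.
by apply/is_derive_y; exact: (is_deriveZr p.[z.1] (is_derive_poly q z.2)).
Qed.

Lemma tensor_C1x p q : C1_x (tensor p q) /\ partial_x (tensor p q) = tensor p^`() q.
Proof.
have E : partial_x (tensor p q) = tensor p^`() q.
  apply/funext => z; have := is_derive_tensor_x p q z => H.
  by rewrite /partial_x derive_val.
split=> //; split; first exact: continuous_tensor.
  by move=> z; exact: (@ex_derive _ _ _ _ _ _ _ (is_derive_tensor_x p q z)).
by rewrite E; exact: continuous_tensor.
Qed.

Lemma tensor_C1y p q : C1_y (tensor p q) /\ partial_y (tensor p q) = tensor p q^`().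
Proof.
have E : partial_y (tensor p q) = tensor p q^`().
  apply/funext => z; have := is_derive_tensor_y p q z => H.
  by rewrite /partial_y derive_val.
split=> //; split; first exact: continuous_tensor.
  by move=> z; exact: (@ex_derive _ _ _ _ _ _ _ (is_derive_tensor_y p q z)).
by rewrite E; exact: continuous_tensor.
Qed.

Variables (I : finType) (a b : I -> nat) (c : I -> R).

Definition bubble_sum z := \sum_i c i * tensor (bubble (a i)) (bubble (b i)) z.
Definition bubble_sum_x z := \sum_i c i * tensor (leg (a i).+1) (bubble (b i)) z.
Definition bubble_sum_y z := \sum_i c i * tensor (bubble (a i)) (leg (b i).+1) z.

Lemma bubble_sum_weak_x phi : test_function phi ->
  dotL2 bubble_sum (partial_x phi) = - dotL2 bubble_sum_x phi.
Proof.
move=> tphi; have [cp _ cdp] := test_function_C1x tphi.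
rewrite !dotL2_suml; do ?[move=> i; exact: tensor_L2]; do ?exact: continuous_L2.
rewrite -sumrN; apply: eq_bigr => i _; rewrite -mulrN -deriv_bubble.
have [C1 <-] := tensor_C1x (bubble (a i)) (bubble (b i)).
by rewrite parts_x.
Qed.

Lemma bubble_sum_weak_y phi : test_function phi ->
  dotL2 bubble_sum (partial_y phi) = - dotL2 bubble_sum_y phi.
Proof.
move=> tphi; have [cp _ cdp] := test_function_C1y tphi.
rewrite !dotL2_suml; do ?[move=> i; exact: tensor_L2]; do ?exact: continuous_L2.
rewrite -sumrN; apply: eq_bigr => i _; rewrite -mulrN -deriv_bubble.
have [C1 <-] := tensor_C1y (bubble (a i)) (bubble (b i)).
by rewrite parts_y.
Qed.

Lemma sum_tensor_L2 (p q : I -> {poly R}) :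
  (fun z => \sum_i c i * tensor (p i) (q i) z) \in L2_square.
Proof. by apply: L2_sum => i; apply: L2_scale; exact: tensor_L2. Qed.

Lemma continuous_sum_tensor (p q : I -> {poly R}) :
  continuous (fun z => \sum_i c i * tensor (p i) (q i) z).
Proof.
rewrite /index_enum; elim: (Finite.enum I) => [|i s IH].
  have -> : (fun z => \sum_(i <- [::]) c i * tensor (p i) (q i) z) = cst 0.
    by apply/funext => y; rewrite big_nil.
  exact: cst_continuous.
have -> : (fun z => \sum_(j <- i :: s) c j * tensor (p j) (q j) z) =
    (fun z => c i * tensor (p i) (q i) z + \sum_(j <- s) c j * tensor (p j) (q j) z).
  by apply/funext => y; rewrite big_cons.
move=> z; apply: cvgD; last exact: IH.
by apply: cvgMr; exact: continuous_tensor.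
Qed.

Definition bubble_H1 : H1_square R := MkH1 (sum_tensor_L2 _ _)
  (sum_tensor_L2 _ _) (sum_tensor_L2 _ _) bubble_sum_weak_x bubble_sum_weak_y.

Lemma continuous_fst : continuous (fst : R * R -> R).
Proof. by move=> z; exact: cvg_fst. Qed.

Lemma continuous_snd : continuous (snd : R * R -> R).
Proof. by move=> z; exact: cvg_snd. Qed.

Lemma is_derive_bigsum (v : R * R) (f df : I -> R * R -> R) z :
  (forall i, is_derive z v (f i) (df i z)) ->
  is_derive z v (fun z => \sum_i f i z) (\sum_i df i z).
Proof.
move=> fdf; rewrite /index_enum; elim: (Finite.enum I) => [|i s IH].
  have -> : (fun z => \sum_(i <- [::]) f i z) = cst 0.
    by apply/funext => y; rewrite big_nil.
  by rewrite big_nil; exact: is_derive_cst.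
have -> : (fun z => \sum_(j <- i :: s) f j z) =
    f i \+ (fun z => \sum_(j <- s) f j z).
  by apply/funext => y; rewrite big_cons.
by rewrite big_cons; exact: is_deriveD.
Qed.

(** Each one-variable bubble is multiplied by its own cutoff; the products and both partial
    derivatives converge boundedly, hence in the norm of H^1. *)
Lemma bubble_sum_H10 : H10_square bubble_H1.
Proof.
have I1 z : square z -> z.1 \in `]-1, 1[ by case.
have I2 z : square z -> z.2 \in `]-1, 1[ by case.
have /choice[dx /all_and2] k : exists d : nat -> R -> R,
    (forall n (x : R), is_derive x 1 (cut_bubble n k) (d n x)) /\
    bounded_cvg (fun n z => d n z.1) (fun z => (leg k.+1).[z.1]).
  by have [d] := cut_bubble_derive continuous_fst I1 k; exists d.
move=> [dxd dxc].
have /choice[dy /all_and2] k : exists d : nat -> R -> R,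
    (forall n (x : R), is_derive x 1 (cut_bubble n k) (d n x)) /\
    bounded_cvg (fun n z => d n z.2) (fun z => (leg k.+1).[z.2]).
  by have [d] := cut_bubble_derive continuous_snd I2 k; exists d.
move=> [dyd dyc].
pose phi n z := \sum_i c i * (cut_bubble n (a i) z.1 * cut_bubble n (b i) z.2).
pose phix n z := \sum_i c i * (dx (a i) n z.1 * cut_bubble n (b i) z.2).
pose phiy n z := \sum_i c i * (cut_bubble n (a i) z.1 * dy (b i) n z.2).
have sphi n : smooth_cut2 n (phi n).
  rewrite /phi /index_enum; elim: (Finite.enum I) => [|i s IH].
    (* The class has no constructor for zero or for scalar multiples: zero and, below, [c i] are
       absorbed into the polynomial factors. *)
    have -> : (fun z => \sum_(i <- [::])
        c i * (cut_bubble n (a i) z.1 * cut_bubble n (b i) z.2)) =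
        (fun z => (0 : {poly R}).[z.1] * flat_cut n 0 z.1 *
                  ((0 : {poly R}).[z.2] * flat_cut n 0 z.2)).
      by apply/funext => z; rewrite big_nil horner0 !mul0r.
    by apply: (@smooth_cut2_base _ n (fun x => _ * _) (fun x => _ * _));
      exact: smooth_cut_base.
  have -> : (fun z => \sum_(j <- i :: s)
      c j * (cut_bubble n (a j) z.1 * cut_bubble n (b j) z.2)) =
    (fun z => ((c i *: bubble (a i)).[z.1] * flat_cut n 0 z.1) *
       ((bubble (b i)).[z.2] * flat_cut n 0 z.2) + \sum_(j <- s)
      c j * (cut_bubble n (a j) z.1 * cut_bubble n (b j) z.2)).
    by apply/funext => z; rewrite big_cons hornerZ /cut_bubble !mulrA.
  apply: smooth_cut2_add IH.
  by apply: (@smooth_cut2_base _ n (fun x => _ * _) (fun x => _ * _));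
      exact: smooth_cut_base.
have px n : partial_x (phi n) = phix n.
  apply/funext => z; rewrite /partial_x.
  suff H : is_derive z (1, 0) (phi n) (phix n z) by rewrite derive_val.
  apply: (@is_derive_bigsum _ _
    (fun i z => c i * (dx (a i) n z.1 * cut_bubble n (b i) z.2))) => i.
  apply/is_derive_x; apply: is_deriveZr.
  exact: (is_deriveZl (cut_bubble n (b i) z.2) (dxd (a i) n z.1)).
have py n : partial_y (phi n) = phiy n.
  apply/funext => z; rewrite /partial_y.
  suff H : is_derive z (0, 1) (phi n) (phiy n z) by rewrite derive_val.
  apply: (@is_derive_bigsum _ _
    (fun i z => c i * (cut_bubble n (a i) z.1 * dy (b i) n z.2))) => i.
  apply/is_derive_y; apply: is_deriveZr.
  exact: (is_deriveZr (cut_bubble n (a i) z.1) (dyd (b i) n z.2)).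
have cphi n : continuous (phi n) by exact: smooth_cut2_continuous (sphi n).
have cphix n : continuous (phix n).
  by rewrite -px; have [df sdf fdf] := smooth_cut2_x (sphi n);
    rewrite (_ : partial_x _ = df); [exact: smooth_cut2_continuous sdf|];
    apply/funext => z; rewrite /partial_x derive_val.
have cphiy n : continuous (phiy n).
  by rewrite -py; have [df sdf fdf] := smooth_cut2_y (sphi n);
    rewrite (_ : partial_y _ = df); [exact: smooth_cut2_continuous sdf|];
    apply/funext => z; rewrite /partial_y derive_val.
have bx i : bounded_cvg (fun n z => cut_bubble n (a i) z.1)
    (fun z => (bubble (a i)).[z.1]).
  exact: bounded_cvg_cut_bubble continuous_fst I1 _.
have by_ i : bounded_cvg (fun n z => cut_bubble n (b i) z.2)
    (fun z => (bubble (b i)).[z.2]).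
  exact: bounded_cvg_cut_bubble continuous_snd I2 _.
have bc (d : R) : bounded_cvg (fun _ _ => d) (fun _ : R * R => d).
  exact: (bounded_cvg_cst (@cst_continuous _ _ d)).
have b0 : bounded_cvg phi bubble_sum.
  by apply: bounded_cvg_sum => i; exact: bounded_cvgM (bc _) (bounded_cvgM (bx i) (by_ i)).
have b1 : bounded_cvg phix bubble_sum_x.
  by apply: bounded_cvg_sum => i; exact: bounded_cvgM (bc _) (bounded_cvgM (dxc _) (by_ i)).
have b2 : bounded_cvg phiy bubble_sum_y.
  by apply: bounded_cvg_sum => i; exact: bounded_cvgM (bc _) (bounded_cvgM (bx i) (dyc _)).
move=> e e0.
pose u n z := (bubble_sum z - phi n z) ^+ 2 + (bubble_sum_x z - phix n z) ^+ 2 +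
  (bubble_sum_y z - phiy n z) ^+ 2.
have cu n : continuous (u n).
  have csq (f g : R * R -> R) : continuous f -> continuous g ->
      continuous (fun z => (f z - g z) ^+ 2).
    move=> cf cg z; under eq_fun do rewrite expr2.
    by apply: cvgM; apply: cvgB; by [exact: cf|exact: cg].
  by move=> z; apply: cvgD; [apply: cvgD|]; apply: csq => //;
    exact: continuous_sum_tensor.
have bu : bounded_cvg u (fun=> 0).
  have c0 : continuous bubble_sum by exact: continuous_sum_tensor.
  have c1 : continuous bubble_sum_x by exact: continuous_sum_tensor.
  have c2 : continuous bubble_sum_y by exact: continuous_sum_tensor.
  have H := bounded_cvgD
    (bounded_cvgD (bounded_cvg_sqrB c0 b0) (bounded_cvg_sqrB c1 b1))
    (bounded_cvg_sqrB c2 b2).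
  by apply: bounded_cvg_ext H => // z; rewrite !addr0.
have := bounded_cvg_integral cu bu.
have e2 : (0 < (e ^+ 2)%:E)%E by rewrite lte_fin exprn_gt0.
move=> /(_ [set x | (x < (e ^+ 2)%:E)%E]) [].
  by apply: open_nbhs_nbhs; split => //; exact: open_ereal_lt_ereal.
move=> n _ /(_ n (leqnn n)) /= un.
exists (phi n); first exact: smooth_cut2_test (sphi n).
by rewrite px py.
Qed.

End BubbleSums.

(** * Integration by parts in H10 *)

Section H10Parts.
Context {R : realType}.
Local Notation mu := (@lebesgue_square R).
Implicit Types (f g h : R * R -> R) (u : H1_square R).

Lemma dotL2_integral h : h \in L2_square ->
  ((dotL2 h h)%:E = \int[mu]_z (h z * h z)%:E)%E.
Proof.
move=> Lh; have := integrable_fin_num measurableT (L2_integrable Lh Lh).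
by move=> /fineK.
Qed.

Lemma dotL2_lt h (F : R * R -> R) e : h \in L2_square -> measurable_fun setT F ->
  (forall z, h z ^+ 2 <= F z) -> (\int[mu]_z (F z)%:E < e%:E)%E ->
  dotL2 h h < e.
Proof.
move=> Lh mF hF; rewrite -lte_fin dotL2_integral//; apply: le_lt_trans.
have mh := L2_measurable Lh.
apply: ge0_le_integral => //.
- by move=> z _; rewrite lee_fin -expr2 sqr_ge0.
- by apply/measurable_realfun.measurable_EFinP; exact: measurable_realfun.measurable_funM.
- by apply/measurable_realfun.measurable_EFinP.
- by move=> z _; rewrite lee_fin -expr2.
Qed.

Lemma L2_sub f g : f \in L2_square -> g \in L2_square ->
  (fun z => f z - g z) \in L2_square.
Proof.
by move=> Lf Lg; apply: eq_L2 (L2_lin (-1) Lg Lf) => z; rewrite mulN1r addrC.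
Qed.

Lemma dotL2B f g h : f \in L2_square -> g \in L2_square -> h \in L2_square ->
  dotL2 (fun z => f z - g z) h = dotL2 f h - dotL2 g h.
Proof.
move=> Lf Lg Lh; rewrite -[RHS]addrC -mulN1r -dotL2_lin//.
by apply: eq_dotL2 => // z; rewrite mulN1r addrC.
Qed.

Lemma dotL2_scaleB a f g h :
  f \in L2_square -> g \in L2_square -> h \in L2_square ->
  dotL2 (fun z => a * (f z - g z)) h = a * (dotL2 f h - dotL2 g h).
Proof.
move=> Lf Lg Lh; rewrite -dotL2B//.
have := dotL2_lin a (L2_sub Lf Lg) (@L2_0 R) Lh; rewrite dotL2_0l addr0 => <-.
by apply: eq_dotL2 => // z; rewrite addr0.
Qed.

Lemma eq0_small (s K : R) : 0 <= K ->
  (forall e, 0 < e -> s ^+ 2 <= 2 * e ^+ 2 * K) -> s = 0.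
Proof.
move=> K0 H; apply/eqP; apply/negPn/negP => s0.
have d0 : 0 < 2 * K + 2 by lra.
(* With this e the bound is s^2 times 2K / (2K + 2)^2, which is less than s^2. *)
have := H (`|s| / (2 * K + 2)); rewrite divr_gt0 ?normr_gt0// => /(_ isT).
rewrite expr_div_n real_normK ?num_real//.
have s2 : 0 < s ^+ 2 by rewrite exprn_even_gt0.
rewrite mulrA mulrAC ler_pdivlMr ?exprn_gt0//; nra.
Qed.

(* [wk] and [partial] stand for [weak_x] and [partial_x], or for [weak_y] and
   [partial_y]. *)
Lemma H10_parts (wk : H1_square R -> R * R -> R)
    (partial : (R * R -> R) -> R * R -> R) u g :
  (forall u, wk u \in L2_square) ->
  (forall phi, test_function phi -> continuous (partial phi)) ->
  (forall phi u z, (wk u z - partial phi z) ^+ 2 <=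
     (weak_x u z - partial_x phi z) ^+ 2 + (weak_y u z - partial_y phi z) ^+ 2) ->
  (forall phi, test_function phi ->
     dotL2 g (partial phi) = - dotL2 (partial g) phi) ->
  continuous g -> continuous (partial g) ->
  H10_square u -> dotL2 (wk u) g = - dotL2 u (partial g).
Proof.
move=> Lwk cpart wle parts cg cpg Hu.
have Lg := continuous_L2 cg; have Lpg := continuous_L2 cpg.
have Lu := H1_fun_L2 u.
apply/eqP; rewrite -addr_eq0; apply/eqP.
apply: (@eq0_small _ (dotL2 g g + dotL2 (partial g) (partial g))).
  by rewrite addr_ge0 ?dotL2_ge0.
move=> e e0; have [phi tphi Hphi] := Hu e e0.
have [cphi _ cpx] := test_function_C1x tphi.
have [_ _ cpy] := test_function_C1y tphi.
have Lphi := continuous_L2 cphi; have Lpphi := continuous_L2 (cpart _ tphi).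
have L1 := L2_sub Lu Lphi; have L2 := L2_sub (Lwk u) Lpphi.
set F := (X in (\int[mu]_z (X z)%:E < _)%E) in Hphi.
have mF : measurable_fun setT F.
  have msq (h k : R * R -> R) : h \in L2_square -> k \in L2_square ->
      measurable_fun setT (fun z => (h z - k z) ^+ 2).
    move=> Lh Lk; apply: measurable_realfun.measurable_funX.
    exact: L2_measurable (L2_sub Lh Lk).
  apply: measurable_realfun.measurable_funD.
    apply: measurable_realfun.measurable_funD; first exact: msq.
    by apply: msq; [exact: weak_x_L2|exact: continuous_L2].
  by apply: msq; [exact: weak_y_L2|exact: continuous_L2].
have lt1 : dotL2 (fun z => u z - phi z) (fun z => u z - phi z) < e ^+ 2.
  apply: dotL2_lt L1 mF _ Hphi => z; rewrite /F -addrA lerDl.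
  by rewrite addr_ge0 ?sqr_ge0.
have lt2 : dotL2 (fun z => wk u z - partial phi z)
    (fun z => wk u z - partial phi z) < e ^+ 2.
  apply: dotL2_lt L2 mF _ Hphi => z; rewrite /F.
  by apply: le_trans (wle phi u z) _; rewrite -addrA lerDr sqr_ge0.
(* The contribution of phi cancels by parts. Each remaining term is small by Cauchy-Schwarz, and
   nothing is asked of [g] on the boundary. *)
have E : dotL2 (wk u) g + dotL2 u (partial g) =
    dotL2 (fun z => wk u z - partial phi z) g +
    dotL2 (fun z => u z - phi z) (partial g).
  rewrite !dotL2B// [dotL2 (partial phi) g]dotL2C parts// [dotL2 phi _]dotL2C.
  ring.
have xs := dotL2_cauchy_schwarz L2 Lg; have yt := dotL2_cauchy_schwarz L1 Lpg.
have s0 := dotL2_ge0 g; have t0 := dotL2_ge0 (partial g); rewrite E.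
move: xs yt s0 t0; set s := dotL2 g g; set t := dotL2 (partial g) (partial g).
set x := dotL2 (fun z => wk u z - partial phi z) g.
set y := dotL2 (fun z => u z - phi z) (partial g) => xs yt s0 t0.
have xe : x ^+ 2 <= e ^+ 2 * s by apply: le_trans xs _; rewrite ler_wpM2r// ltW.
have ye : y ^+ 2 <= e ^+ 2 * t by apply: le_trans yt _; rewrite ler_wpM2r// ltW.
by have := sqr_ge0 (x - y); nra.
Qed.

Lemma H10_parts_x u g : C1_x g -> H10_square u ->
  dotL2 (weak_x u) g = - dotL2 u (partial_x g).
Proof.
move=> Cg; have [cg _ cpg] := Cg; apply: H10_parts => //.
- by move=> v; exact: weak_x_L2.
- by move=> phi /test_function_C1x[].
- by move=> phi v z; rewrite lerDl sqr_ge0.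
- by move=> phi; exact: parts_x.
Qed.

Lemma H10_parts_y u g : C1_y g -> H10_square u ->
  dotL2 (weak_y u) g = - dotL2 u (partial_y g).
Proof.
move=> Cg; have [cg _ cpg] := Cg; apply: H10_parts => //.
- by move=> v; exact: weak_y_L2.
- by move=> phi /test_function_C1y[].
- by move=> phi v z; rewrite lerDr sqr_ge0.
- by move=> phi; exact: parts_y.
Qed.

End H10Parts.

(** * Stability of the smooth truncation *)

Section EnergyBound.
Context {R : realType}.
Implicit Types (i j k n : nat).

(** Summation by parts with step two. Vanishing at 0 and 1 will come from the moments, vanishing at
    N + 2 and N + 3 from the damping factor. *)
Lemma abel_step2 (Z L : nat -> R) N : Z 0%N = 0 -> Z 1%N = 0 ->
  Z N.+2 = 0 -> Z N.+3 = 0 ->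
  \sum_(j < N) Z j.+2 * (L j.+2 - L j) =
  \sum_(k < N.+2) (Z k - Z k.+2) * L k.
Proof.
move=> Z0 Z1 ZN ZN1.
under eq_bigr do rewrite mulrBr.
under [RHS]eq_bigr do rewrite mulrBl.
rewrite !big_split /= !sumrN; congr (_ - _).
  by rewrite [RHS]big_ord_recl [X in _ = _ + X]big_ord_recl /= Z0 Z1 !mul0r !add0r.
by rewrite [RHS]big_ord_recr [X in _ = X + _]big_ord_recr /= ZN ZN1 !mul0r !addr0.
Qed.

(* [T] stands for [tensor] or for [tensor] with its arguments exchanged. *)
Variables (T : {poly R} -> {poly R} -> R * R -> R).
Hypothesis T_L2 : forall p q, T p q \in L2_square.
Hypothesis dotT : forall p q r s,
  dotL2 (T p q) (T r s) = pint (p * r) * pint (q * s).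
Hypothesis TZB : forall p q r a z, T p (a *: (q - r)) z = a * (T p q z - T p r z).
Variables (g : R * R -> R) (U : nat -> nat -> R) (mult : nat -> R).
Variables (N : nat) (delta : R).
Hypothesis Lg : g \in L2_square.
Hypothesis U0 : forall i, U i 0 = 0.
Hypothesis U1 : forall i, U i 1 = 0.
(** [g] stands for a weak derivative of u and [U] for the moments of u: this is integration by parts
    followed by [leg_dleg] in the other variable. *)
Hypothesis gT : forall i k, dotL2 g (T (leg i.+1) (leg k)) =
  - (leg_sqnorm k / 2 * (U i k.+2 - U i k)).
Hypothesis mult_le1 : forall n, `|mult n| <= 1.
Hypothesis mult_lip : forall n, `|mult n - mult n.+2| <= delta.
Hypothesis mult0 : forall n, (N < n)%N -> mult n = 0.

(** Division by the two square norms follows from [pint_bubble_dleg]. The first index of [U] is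
    already shifted by two, the second is not: hence [j.+2]. *)
Definition trunc_coef i j : R :=
  mult (i + j.+2) * U i j.+2 / (leg_sqnorm i.+1 * leg_sqnorm j.+1).

Let h z := \sum_(a : 'I_N * 'I_N)
  trunc_coef a.1 a.2 * T (leg a.1.+1) (bubble a.2) z.

(** Normalised so that the coefficient of [g] on T(L_(i+1), L_k) is exactly [e i k - e i k.+2]. *)
Let e i k : R := U i k / (2 * leg_sqnorm i.+1).

Let hE z : h z = \sum_(a : 'I_N * 'I_N.+2)
  (mult (a.1 + a.2) * e a.1 a.2 - mult (a.1 + a.2.+2) * e a.1 a.2.+2)
  * T (leg a.1.+1) (leg a.2) z.
Proof.
rewrite /h -(pair_bigA _ (fun i j : 'I_N =>
  trunc_coef i j * T (leg i.+1) (bubble j) z)) /=.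
rewrite -(pair_bigA _ (fun (i : 'I_N) (k : 'I_N.+2) =>
  (mult (i + k) * e i k - mult (i + k.+2) * e i k.+2) *
  T (leg i.+1) (leg k) z)) /=.
apply: eq_bigr => i _.
rewrite -(@abel_step2 (fun k => mult (i + k) * e i k)
  (fun k => T (leg i.+1) (leg k) z)); last 4 first.
- by rewrite /e U0 mul0r mulr0.
- by rewrite /e U1 mul0r mulr0.
- by rewrite mult0 ?mul0r// (leq_trans _ (leq_addl _ _)).
- by rewrite mult0 ?mul0r// (leq_trans _ (leq_addl _ _))// 2?leqW.
apply: eq_bigr => j _; rewrite bubbleE TZB mulrA; congr (_ * _).
have n1 : 2 * j.+1%:R + 1 != 0 :> R by rewrite -natrM natr1 pnatr_eq0.
have n2 : 2 * i.+1%:R + 1 != 0 :> R by rewrite -natrM natr1 pnatr_eq0.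
rewrite /trunc_coef /e /leg_sqnorm; field.
by rewrite !nat1r n1 n2.
Qed.

(** Parseval for the finite sum [h], only Bessel for [g], and [hardy_multiplier] between them for
    each fixed i. The sums in k have N + 2 terms because [bubble j] involves L_(j+2). *)
Lemma energy_bound : dotL2 h h <=
  2 * (1 + (delta * N.+2%:R) ^+ 2) * dotL2 g g.
Proof.
pose b (a : 'I_N * 'I_N.+2) := T (leg a.1.+1) (leg a.2).
pose c (a : 'I_N * 'I_N.+2) := leg_sqnorm a.1.+1 * leg_sqnorm a.2 : R.
have c0 a : 0 < c a by rewrite mulr_gt0 ?leg_sqnorm_gt0.
have bb x y : dotL2 (b x) (b y) = c x *+ (x == y).
  rewrite /b /c dotT !pint_leg_leg eqSS; case: x y => [x1 x2] [y1 y2] /=.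
  rewrite xpair_eqE -!val_eqE /=.
  have [->|_] := eqVneq (x1 : nat) y1; last by rewrite !mulr0n mul0r.
  by have [->|_] := eqVneq (x2 : nat) y2; rewrite ?mulr0n ?mulr0.
have := dotL2_bessel (fun a => T_L2 _ _) Lg c0 bb.
pose S := \sum_(i < N) leg_sqnorm i.+1 *
  \sum_(k < N.+2) leg_sqnorm k * (e i k - e i k.+2) ^+ 2.
have -> : \sum_a dotL2 g (b a) ^+ 2 / c a = S.
  rewrite /S -(pair_bigA _ (fun (i : 'I_N) (k : 'I_N.+2) =>
    dotL2 g (b (i, k)) ^+ 2 / c (i, k))) /=.
  apply: eq_bigr => i _; rewrite mulr_sumr; apply: eq_bigr => k _.
  rewrite /b /c /= gT /e.
  have := leg_sqnorm_gt0 i.+1 (R := R); have := leg_sqnorm_gt0 k (R := R).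
  set s := leg_sqnorm _; set t := leg_sqnorm _ => s0 t0.
  by field; rewrite !gt_eqF.
move=> SG.
have K0 : 0 <= 2 * (1 + (delta * N.+2%:R) ^+ 2) by have := sqr_ge0 (delta * N.+2%:R); lra.
apply: le_trans (ler_wpM2l K0 SG).
rewrite (eq_dotL2 hE hE) (dotL2_parseval _ (fun a => T_L2 _ _) bb).
rewrite -(pair_bigA _ (fun (i : 'I_N) (k : 'I_N.+2) => c (i, k) *
  (mult (i + k) * e i k - mult (i + k.+2) * e i k.+2) ^+ 2)) /=.
rewrite /S mulr_sumr; apply: ler_sum => i _.
rewrite [leRHS]mulrCA (_ : \sum_(_ < _) _ = leg_sqnorm i.+1 *
  \sum_(k < N.+2) leg_sqnorm k *
    (mult (i + k) * e i k - mult (i + k.+2) * e i k.+2) ^+ 2); last first.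
  by rewrite mulr_sumr; apply: eq_bigr => k _; rewrite /c mulrA.
apply: ler_wpM2l; first by rewrite ltW// leg_sqnorm_gt0.
have e0 : e i 0 = 0 by rewrite /e U0 mul0r.
have e1 : e i 1 = 0 by rewrite /e U1 mul0r.
apply: (@hardy_multiplier R (e i) (fun k => mult (i + k)) (@leg_sqnorm R)
  N.+2 delta e0 e1).
- by move=> k; rewrite ltW// leg_sqnorm_gt0.
- exact: leg_sqnorm_le.
- by move=> k; exact: mult_le1.
- by move=> k; rewrite 2!addnS; exact: mult_lip.
Qed.

End EnergyBound.

(** * The damping factor *)

Section TruncationFactor.
Context {R : realType}.
Variables (p q : nat).
Hypothesis pq : (p + 5 <= q)%N.

(* The product of [bubble i] and [bubble j] has total degree [i + j + 4]; its
   coefficient is damped by the factor at [n = i + j + 2], hence a factor 1 up to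
   total degree [p + 4] and 0 beyond [q]. *)
Definition trunc_factor (n : nat) : R :=
  Num.min 1 (Num.max 0 ((q.+1%:R - n.+2%:R) / (q%:R - p%:R - 3))).

Lemma trunc_den_gt0 : 0 < q%:R - p%:R - 3 :> R.
Proof.
have : (p + 5)%:R <= q%:R :> R by rewrite ler_nat.
by rewrite natrD; lra.
Qed.

Lemma trunc_factor_le1 n : `|trunc_factor n| <= 1.
Proof.
rewrite ger0_norm ?ge_min ?lexx// /trunc_factor le_min ler01/=.
by rewrite le_max lexx.
Qed.

Lemma trunc_factor_lip n :
  `|trunc_factor n - trunc_factor n.+2| <= 2 / (q%:R - p%:R - 3).
Proof.
have clamp (x y : R) : y <= x ->
    `|Num.min 1 (Num.max 0 x) - Num.min 1 (Num.max 0 y)| <= x - y.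
  have m0 : Num.min 1 0 = 0 :> R by rewrite min_r.
  move=> xy; rewrite ler_norml.
  by case: (leP 0 x) => ?; case: (leP 0 y) => ?; rewrite ?m0;
    case: (leP 1 x) => ?; case: (leP 1 y) => ?; apply/andP; split; lra.
have d0 := trunc_den_gt0.
rewrite /trunc_factor; set x := (X in Num.min 1 (Num.max 0 X)).
set y := (X in _ - Num.min 1 (Num.max 0 X)).
have E : x - y = 2 / (q%:R - p%:R - 3).
  by rewrite /x /y -mulrBl -[n.+4]addn2 natrD; congr (_ / _); ring.
rewrite -E; apply: clamp; rewrite -subr_ge0 E.
by rewrite divr_ge0// ltW.
Qed.

Lemma trunc_factor0 n : (q < n.+2)%N -> trunc_factor n = 0.
Proof.
move=> qn; rewrite /trunc_factor max_l ?min_r// pmulr_lle0 ?invr_gt0 ?trunc_den_gt0//.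
by rewrite subr_le0 ler_nat.
Qed.

(** At n = p + 2 the numerator q - 1 - n equals the denominator; this is the origin of the 3. *)
Lemma trunc_factor1 n : (n <= p.+2)%N -> trunc_factor n = 1.
Proof.
move=> np; have d0 := trunc_den_gt0; rewrite /trunc_factor min_l// le_max.
apply/orP; right; rewrite ler_pdivlMr// mul1r.
have : n%:R <= p.+2%:R :> R by rewrite ler_nat.
by rewrite -[p.+2]addn2 -[n.+2]addn2 -[q.+1]addn1 !natrD; lra.
Qed.

End TruncationFactor.

(** * Truncation preserves low-degree moments *)

Section Moments.
Context {R : realType}.
Implicit Types (f g : R * R -> R).

(** X^i lies in the span of the [dleg a.+2] with a <= i, so the expansion of the product does not
    raise the total degree. *)
Lemma dotL2_tensor_eq f g (n : nat) : f \in L2_square -> g \in L2_square ->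
  (forall a b, (a + b <= n)%N -> dotL2 f (tensor (dleg a.+2) (dleg b.+2)) =
     dotL2 g (tensor (dleg a.+2) (dleg b.+2))) ->
  forall i j, (i + j <= n)%N ->
    dotL2 f (tensor 'X^i 'X^j) = dotL2 g (tensor 'X^i 'X^j).
Proof.
move=> Lf Lg fg i j ijn.
have [c Ec] : exists c : nat -> R, 'X^i = \sum_(k < i.+1) c k *: dleg k.+2.
  by apply: dleg_span; rewrite size_polyXn.
have [d Ed] : exists d : nat -> R, 'X^j = \sum_(k < j.+1) d k *: dleg k.+2.
  by apply: dleg_span; rewrite size_polyXn.
have tensE z : tensor 'X^i 'X^j z = \sum_(x : 'I_i.+1 * 'I_j.+1)
    (c x.1 * d x.2) * tensor (dleg x.1.+2) (dleg x.2.+2) z.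
  rewrite /tensor Ec Ed !horner_sum big_distrlr /= pair_bigA /=.
  by apply: eq_bigr => x _; rewrite !hornerZ mulrACA.
rewrite ![dotL2 _ (tensor 'X^i _)]dotL2C.
rewrite !(eq_dotL2 tensE (fun=> erefl)).
rewrite !dotL2_suml; do ?[by []|by move=> x; exact: tensor_L2].
apply: eq_bigr => -[x y] _ /=; congr (_ * _).
rewrite ![dotL2 (tensor _ _) _]dotL2C; apply: fg.
by apply: leq_trans ijn; rewrite leq_add// -ltnS.
Qed.

Lemma dotL2_poly_eq f g h (n : nat) : f \in L2_square -> g \in L2_square ->
  (forall a b, (a + b <= n)%N -> dotL2 f (tensor (dleg a.+2) (dleg b.+2)) =
     dotL2 g (tensor (dleg a.+2) (dleg b.+2))) ->
  poly_square n h -> dotL2 h f = dotL2 h g.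
Proof.
move=> Lf Lg /(dotL2_tensor_eq Lf Lg) fg [P Pdeg ->].
pose m := \max_(j < size P) size (P`_j)%R.
have hE z : P.[z.2%:P].[z.1] = \sum_(x : 'I_m * 'I_(size P))
    P`_(x.2)`_(x.1) * tensor 'X^(x.1) 'X^(x.2) z.
  rewrite (horner_coef P) horner_sum.
  rewrite -(pair_bigA _ (fun (i : 'I_m) (j : 'I_(size P)) =>
    P`_j`_i * tensor 'X^i 'X^j z)) exchange_big /=; apply: eq_bigr => j _.
  rewrite hornerM -rmorphXn /= hornerC (horner_coef_wide (n := m)); last first.
    exact: (leq_bigmax (F := fun j : 'I_(size P) => size (P`_j)%R) j).
  rewrite mulr_suml; apply: eq_bigr => i _.
  by rewrite /tensor !hornerXn mulrA.
rewrite !(eq_dotL2 hE (fun=> erefl)).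
rewrite !dotL2_suml; do ?[by []|by move=> x; exact: tensor_L2].
apply: eq_bigr => -[x y] _ /=.
have [->|Pxy] := eqVneq (P`_y`_x) 0; first by rewrite !mul0r.
by congr (_ * _); rewrite ![dotL2 (tensor _ _) _]dotL2C fg// addnC Pdeg.
Qed.

Lemma bubble_sum_moment (N : nat) (c : nat -> nat -> R) a b :
  (a < N)%N -> (b < N)%N ->
  dotL2 (bubble_sum (fun x : 'I_N * 'I_N => x.1 : nat)
     (fun x => x.2 : nat) (fun x => c x.1 x.2))
    (tensor (dleg a.+2) (dleg b.+2)) =
  c a b * (leg_sqnorm a.+1 * leg_sqnorm b.+1).
Proof.
move=> aN bN; rewrite dotL2_suml; do ?[exact: tensor_L2|by move=> x; exact: tensor_L2].
rewrite (bigD1 (Ordinal aN, Ordinal bN))//= big1 ?addr0.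
  by rewrite dotL2_tensor !pint_bubble_dleg !eqxx !mulr1n mulrNN.
move=> [x y] /= xy; rewrite dotL2_tensor !pint_bubble_dleg mulrNN.
move: xy; rewrite xpair_eqE -!val_eqE /= negb_and => /orP[] /negbTE ->.
  by rewrite mulr0n mul0r mulr0.
by rewrite mulr0n mulr0 mulr0.
Qed.

Lemma bubble_sum_poly (N q : nat) (c : nat -> nat -> R) :
  (forall i j, (q < i + j + 4)%N -> c i j = 0) ->
  poly_square q (bubble_sum (fun x : 'I_N * 'I_N => x.1 : nat)
     (fun x => x.2 : nat) (fun x => c x.1 x.2)).
Proof.
move=> c0; exists (\sum_(x : 'I_N * 'I_N)
    (c x.1 x.2 *: bubble x.1)%:P * map_poly polyC (bubble x.2)).
  move=> b a; apply: contra_neqT; rewrite -ltnNge => qab.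
  rewrite !coef_sum; apply: big1 => -[x y] _ /=.
  rewrite coefCM coef_map coefMC coefZ.
  have [abig|asmall] := leqP (x + 3) a.
    by rewrite [(bubble x)`_a]nth_default ?mulr0 ?mul0r// (leq_trans _ abig)// size_bubble.
  have [bbig|bsmall] := leqP (y + 3) b.
    by rewrite [(bubble y)`_b]nth_default ?mulr0// (leq_trans _ bbig)// size_bubble.
  rewrite addnS ltnS in asmall; rewrite addnS ltnS in bsmall.
  rewrite c0 ?mul0r//; apply: leq_trans qab _.
  rewrite (_ : x + y + 4 = (y + 2) + (x + 2))%N ?leq_add//.
  by rewrite addnACA [(y + x)%N]addnC.
apply/funext => z; rewrite horner_sum horner_sum.
apply: eq_bigr => x _; rewrite hornerM hornerC horner_map hornerM hornerC hornerZ.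
by rewrite /tensor mulrA.
Qed.

End Moments.

(** * The damped polynomial: energy, membership in V_q and duality with f *)

Section Truncation.
Context {R : realType}.
Variables (p q : nat).
Hypothesis pq : (p + 5 <= q)%N.
Variable u : H1_square R.
Hypothesis Hu : H10_square u.

Lemma dotH10E (v w : H1_square R) :
  dotH10 v w = dotL2 (weak_x v) (weak_x w) + dotL2 (weak_y v) (weak_y w).
Proof.
rewrite /dotH10 /dotL2 -RintegralD//.
- exact: L2_integrable (weak_x_L2 v) (weak_x_L2 w).
- exact: L2_integrable (weak_y_L2 v) (weak_y_L2 w).
Qed.

Let mult := @trunc_factor R p q.
Let U i j : R := dotL2 u (tensor (dleg i.+2) (dleg j)).
(** The same moments with the coordinates exchanged, [V j i.+2 = U i j.+2], so that [energy_bound]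
    also serves the y-derivative. *)
Let V j i : R := dotL2 u (tensor (dleg i) (dleg j.+2)).

Let coef i j := trunc_coef U mult i j.

Definition truncation : H1_square R :=
  bubble_H1 (fun x : 'I_q * 'I_q => x.1 : nat) (fun x => x.2 : nat)
    (fun x => coef x.1 x.2).

Let delta : R := 2 / (q%:R - p%:R - 3).

Let lin_tensor_r (P Q S : {poly R}) a z :
  tensor P (a *: (Q - S)) z = a * (tensor P Q z - tensor P S z).
Proof. by rewrite /tensor hornerZ hornerD hornerN; ring. Qed.

Let lin_tensor_l (P Q S : {poly R}) a z :
  tensor (a *: (Q - S)) P z = a * (tensor Q P z - tensor S P z).
Proof. by rewrite /tensor hornerZ hornerD hornerN; ring. Qed.

Let Lu := H1_fun_L2 u.

Let dot_lin_r (P Q S : {poly R}) a :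
  dotL2 u (tensor P (a *: (Q - S))) =
  a * (dotL2 u (tensor P Q) - dotL2 u (tensor P S)).
Proof.
rewrite ![dotL2 u _]dotL2C -dotL2_scaleB; do ?[exact: tensor_L2|exact: Lu].
by apply: eq_dotL2 => // z; rewrite lin_tensor_r.
Qed.

Let dot_lin_l (P Q S : {poly R}) a :
  dotL2 u (tensor (a *: (Q - S)) P) =
  a * (dotL2 u (tensor Q P) - dotL2 u (tensor S P)).
Proof.
rewrite ![dotL2 u _]dotL2C -dotL2_scaleB; do ?[exact: tensor_L2|exact: Lu].
by apply: eq_dotL2 => // z; rewrite lin_tensor_l.
Qed.

Let mult0 n : (q < n)%N -> mult n = 0.
Proof. by move=> qn; rewrite /mult trunc_factor0// (leq_trans qn)// -addn2 leq_addr. Qed.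

Let K : R := 2 * (1 + (delta * q.+2%:R) ^+ 2).

Lemma truncation_energy_x :
  dotL2 (weak_x truncation) (weak_x truncation) <= K * dotL2 (weak_x u) (weak_x u).
Proof.
apply: (@energy_bound R tensor (@tensor_L2 R) (@dotL2_tensor R) lin_tensor_r
  (weak_x u) U mult q delta (weak_x_L2 u)).
- by move=> i; rewrite /U dleg0 dotL2C (@eq_dotL2 _ _ (fun=> 0) _ u) ?dotL2_0l// => z;
    rewrite /tensor horner0 mulr0.
- by move=> i; rewrite /U dleg1 dotL2C (@eq_dotL2 _ _ (fun=> 0) _ u) ?dotL2_0l// => z;
    rewrite /tensor horner0 mulr0.
(* The tensor is not zero on the boundary: this is where membership of u in H^1_0 enters. *)
- move=> i k; have [C1 E] := @tensor_C1x R (leg i.+1) (leg k).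
  by rewrite (H10_parts_x C1 Hu) E (leg_dleg k) dot_lin_r.
- exact: trunc_factor_le1.
- exact: trunc_factor_lip pq.
- exact: mult0.
Qed.

Lemma truncation_energy_y :
  dotL2 (weak_y truncation) (weak_y truncation) <= K * dotL2 (weak_y u) (weak_y u).
Proof.
(* The coefficients are unchanged under the exchange, since the damping factor depends on i + j
   only. *)
have E z : weak_y truncation z = \sum_(a : 'I_q * 'I_q)
    trunc_coef V mult a.1 a.2 * tensor (bubble a.2) (leg a.1.+1) z.
  rewrite /= /bubble_sum_y.
  rewrite -(pair_bigA _ (fun i j : 'I_q => coef i j * tensor (bubble i) (leg j.+1) z)).
  rewrite -(pair_bigA _ (fun i j : 'I_q =>
    trunc_coef V mult i j * tensor (bubble j) (leg i.+1) z)) /=.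
  rewrite exchange_big; apply: eq_bigr => j _; apply: eq_bigr => i _.
  congr (_ * _); rewrite /coef /trunc_coef /U /V [leg_sqnorm i.+1 * _]mulrC.
  by rewrite !addnS addnC.
rewrite (eq_dotL2 E E).
apply: (@energy_bound R (fun P Q => tensor Q P) (fun P Q => tensor_L2 Q P)
  _ lin_tensor_l (weak_y u) V mult q delta (weak_y_L2 u)).
- by move=> P Q S T; rewrite dotL2_tensor mulrC.
- by move=> i; rewrite /V dleg0 dotL2C (@eq_dotL2 _ _ (fun=> 0) _ u) ?dotL2_0l// => z;
    rewrite /tensor horner0 mul0r.
- by move=> i; rewrite /V dleg1 dotL2C (@eq_dotL2 _ _ (fun=> 0) _ u) ?dotL2_0l// => z;
    rewrite /tensor horner0 mul0r.
- move=> i k; have [C1 E'] := @tensor_C1y R (leg k) (leg i.+1).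
  by rewrite (H10_parts_y C1 Hu) E' (leg_dleg k) dot_lin_l.
- exact: trunc_factor_le1.
- exact: trunc_factor_lip pq.
- exact: mult0.
Qed.

Lemma truncation_energy : dotH10 truncation truncation <= K * dotH10 u u.
Proof. by rewrite !dotH10E mulrDr lerD// ?truncation_energy_x ?truncation_energy_y. Qed.

Lemma truncation_Vspace : Vspace q truncation.
Proof.
split; first exact: bubble_sum_H10.
exists (truncation : R * R -> R); last by apply: ae_square.
apply: bubble_sum_poly => i j qij.
by rewrite /coef /trunc_coef /mult trunc_factor0 ?mul0r// (leq_trans qij)// addn4 !addnS.
Qed.

Lemma truncation_dual f : poly_square p f -> dotL2 f truncation = dotL2 f u.
Proof.
move=> Hf; apply: dotL2_poly_eq Hf; [exact: H1_fun_L2|exact: Lu|] => a b abp.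
have ltq : (p < q)%N by apply: leq_trans pq; rewrite addnS ltnS leq_addr.
have aq : (a < q)%N.
  by apply: leq_ltn_trans ltq; rewrite (leq_trans _ abp)// leq_addr.
have bq : (b < q)%N.
  by apply: leq_ltn_trans ltq; rewrite (leq_trans _ abp)// leq_addl.
rewrite (bubble_sum_moment coef aq bq) /coef /trunc_coef.
(* The index is a + b + 2, at most p + 2, so there is no damping. *)
rewrite /mult trunc_factor1 ?mul1r//; last first.
  by rewrite !addnS !ltnS.
by rewrite divfK// mulf_neq0// gt_eqF// leg_sqnorm_gt0.
Qed.

End Truncation.

(** * Cauchy-Schwarz for the energy, and the final estimate *)

Lemma dotH10_cauchy_schwarz {R : realType} (v w : H1_square R) :
  dotH10 v w ^+ 2 <= dotH10 v v * dotH10 w w.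
Proof.
rewrite !dotH10E.
have := dotL2_cauchy_schwarz (weak_x_L2 v) (weak_x_L2 w).
have := dotL2_cauchy_schwarz (weak_y_L2 v) (weak_y_L2 w).
have := dotL2_ge0 (weak_x v); have := dotL2_ge0 (weak_y v).
have := dotL2_ge0 (weak_x w); have := dotL2_ge0 (weak_y w).
move: (dotL2 (weak_x v) (weak_x v)) (dotL2 (weak_y v) (weak_y v)).
move: (dotL2 (weak_x w) (weak_x w)) (dotL2 (weak_y w) (weak_y w)).
move: (dotL2 (weak_x v) (weak_x w)) (dotL2 (weak_y v) (weak_y w)).
move=> a b A2 B2 A1 B1 B2p A2p B1p A1p bb aa.
(* The cross term, from (2ab)^2 <= 4 A1 A2 B1 B2 <= (A1 B2 + B1 A2)^2. *)
suff : 2 * a * b <= A1 * B2 + B1 * A2 by nra.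
have s0 : 0 <= A1 * B2 + B1 * A2 by rewrite addr_ge0 ?mulr_ge0.
apply: le_trans (ler_norm _) _.
rewrite -ler_sqr ?nnegrE// real_normK ?num_real//.
have h : a ^+ 2 * b ^+ 2 <= A1 * A2 * (B1 * B2).
  by rewrite ler_pM ?sqr_ge0.
have := sqr_ge0 (A1 * B2 - B1 * A2); nra.
Qed.

Theorem theorem1p1 (R : realType) :
  exists2 C : R, 0 < C &
    forall (lambda : R) (q : nat -> nat),
      1 < lambda ->
      (forall p : nat, (0 < q p)%N) ->
      (forall p : nat, Num.max (lambda * p%:R) (p%:R + 4%:R) < (q p)%:R) ->
      forall (p : nat) (f : R * R -> R) (u uq : H1_square R),
        poly_square p f ->
        dirichlet_solution f u ->
        galerkin_solution (q p) f uq ->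
        normH10 u <= C * (lambda / (lambda - 1)) * normH10 uq.
Proof.
(* The constant comes from 2 (1 + (7 r)^2) <= (10 r)^2, valid since r >= 1. *)
exists 10 => // lambda q lambda1 _ qp p f u uq Hf [Hu solu] [_ soluq].
have := qp p; rewrite gt_max => /andP[q1 q2].
have pq : (p + 5 <= q p)%N.
  by rewrite addnS -(ltr_nat R) natrD.
set r := lambda / (lambda - 1).
have l1 : 0 < lambda - 1 by lra.
have qpos : 0 < (q p)%:R - p%:R :> R by lra.
(* After clearing denominators this is lambda p <= q. *)
have r0 : (q p)%:R / ((q p)%:R - p%:R) <= r.
  by rewrite /r ler_pdivrMr// mulrAC ler_pdivlMr//; nra.
have r1 : 1 <= r by rewrite /r ler_pdivlMr//; lra.
have qp5 : p%:R + 5 <= (q p)%:R :> R by rewrite -[5]/(5%:R) -natrD ler_nat.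
have p0 : 0 <= p%:R :> R by [].
have d0 := @trunc_den_gt0 R _ _ pq.
(* From q - p >= 5 and q >= 5: q + 2 <= (7/5) q and q - p <= (5/2)(q - p - 3), whence 2 (7/5)(5/2) =
   7. *)
have dr : 2 / ((q p)%:R - p%:R - 3) * (q p).+2%:R <= 7 * r.
  apply: (@le_trans _ _ (7 * ((q p)%:R / ((q p)%:R - p%:R)))); last by rewrite ler_pM2l.
  rewrite mulrAC ler_pdivrMr// mulrA mulrAC ler_pdivlMr// -[(q p).+2]addn2 natrD.
  nra.
set S := dotH10 uq uq; set X := dotH10 u u.
pose w := truncation p (q p) u.
have Xw : X = dotH10 uq w.
  rewrite /X solu// soluq; last exact: truncation_Vspace.
  by rewrite truncation_dual.
have Ww := truncation_energy pq Hu; rewrite -/w -/X in Ww.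
have X0 : 0 <= X by rewrite /X dotH10E addr_ge0 ?dotL2_ge0.
have S0 : 0 <= S by rewrite /S dotH10E addr_ge0 ?dotL2_ge0.
have CS := dotH10_cauchy_schwarz uq w; rewrite -Xw -/S in CS.
set t := 2 / _ * _ in dr Ww.
have t0 : 0 <= t by rewrite mulr_ge0// divr_ge0// ltW.
have K1 : 2 * (1 + t ^+ 2) <= (10 * r) ^+ 2.
  have : t ^+ 2 <= (7 * r) ^+ 2 by rewrite ler_sqr ?nnegrE//; lra.
  nra.
(* Cauchy-Schwarz gives X^2 <= S |w|^2 <= (10 r)^2 S X, and one factor X is divided out when it is
   nonzero. *)
have XS : X <= (10 * r) ^+ 2 * S.
  have [->|Xn0] := eqVneq X 0; first by rewrite mulr_ge0 ?sqr_ge0.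
  have Xp : 0 < X by rewrite lt_def Xn0.
  rewrite -(ler_pM2r Xp) -expr2; apply: le_trans CS _.
  rewrite mulrC -mulrA [S * X]mulrC mulrA ler_wpM2r//.
  by apply: le_trans Ww _; rewrite ler_wpM2r.
rewrite /normH10 -/X -/S.
apply: le_trans (ler_wsqrtr XS) _.
by rewrite sqrtrM ?sqr_ge0// sqrtr_sqr ger0_norm//; lra.
Qed.
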